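(* Assume that there is a constant $L<+\infty$ with $\|\nabla H(\mathbf x)\|_2\le L$ for $\omega$-almost every $\mathbf x\in D$. Let $r>0$ and suppose that $$\mathscr K_N\le\lambda\frac{K}{\log K},\qquad \lambda:=\frac{3\log(3/2)-1}{2+2r}.$$ Then $$\mathbb E\Big(\big\|\nabla H-\mathbf T_L(\nabla\widetilde H)\big\|_{2,\mathbb L^2_\omega}^2\Big)\le\Big(1+\frac{8\lambda}{\log K}\Big)\big\|\nabla H-\Pi_{\mathbb V}(\nabla H)\big\|_{2,\mathbb L^2_\omega}^2+\frac{8L^2}{K^r}+8N\tau_\infty^2,$$ where the expectation is taken over the random sequence $\{\mathbf x_k\}_{k=1}^K$, $$\mathbf T_L(\mathbf x)=\frac{L}{\max\{\|\mathbf x\|_2,L\}}\,\mathbf x,$$ and $\Pi_{\mathbb V}(\nabla H)$ is the orthogonal projection of $\nabla H$ onto $\mathbb V$, i.e. $\Pi_{\mathbb V}(\nabla H)=\mathop{\rm argmin}_{\nabla h\in\mathbb V}\int_D\|\nabla H-\nabla h\|_2^2\,d\omega$.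
   Context: Let $d\ge1$, $D\subset\mathbb R^{2d}$ a bounded domain, $\omega$ a probability measure on $D$, and $\mathbf J=\begin{pmatrix}\mathbf 0_d&\mathbf I_d\\-\mathbf I_d&\mathbf 0_d\end{pmatrix}$ with $d\times d$ blocks. The Hamiltonian $H$ is continuously differentiable and belongs to $\mathbb H^1_\omega(D)$, the weighted Sobolev space with inner product $(g,h)=\int_D(gh+\nabla g\cdot\nabla h)\,d\omega$. Let $\mathbb W\subset\mathbb H^1_\omega(D)$ be a finite-dimensional subspace (gradients of its elements can be evaluated pointwise), $\mathbb V=\{\nabla h:h\in\mathbb W\}$, $N=\dim\mathbb V\ge1$. Choose $\phi_1,\dots,\phi_N\in\mathbb W$ such that $\{\nabla\phi_j\}_{j=1}^N$ is a basis of $\mathbb V$ with $\int_D\nabla\phi_i\cdot\nabla\phi_j\,d\omega=\delta_{ij}$, and set $\mathscr K_N=\sup_{\mathbf x\in D}\sum_{j=1}^N\|\nabla\phi_j(\mathbf x)\|_2^2$ (independent of the choice of orthonormal basis). For a vector field $\mathbf g$, $\|\mathbf g\|_{2,\mathbb L^2_\omega}^2=\int_D\|\mathbf g(\mathbf x)\|_2^2\,d\omega(\mathbf x)$; $\mathbf T_L(\mathbf g)$ is the field $\mathbf x\mapsto\mathbf T_L(\mathbf g(\mathbf x))$ (with $\mathbf T_L(\mathbf 0)=\mathbf 0$ also if $L=0$). $\log$ is the natural logarithm. Data: $\mathbf x_1,\dots,\mathbf x_K$, with $N<K$, are drawn i.i.d. from $\omega$, without noise. The time-derivative data $\dot{\mathbf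 x}_k$ carry errors $\boldsymbol\tau_k:=\dot{\mathbf x}_k-\mathbf J^{-1}\nabla H(\mathbf x_k)$ that are uniformly bounded: $\|\boldsymbol\tau_k\|_2\le\tau_\infty<+\infty$ for all $k$ and all draws (no independence or distributional assumption is made on the $\boldsymbol\tau_k$). The approximation $\nabla\widetilde H\in\mathbb V$ is a minimizer of $\sum_{k=1}^K\|\mathbf J\dot{\mathbf x}_k-\nabla h(\mathbf x_k)\|_2^2$ over $\nabla h\in\mathbb V$. All random quantities are taken to be measurable. *)

(* Defs.v *)
From HB Require Import structures.
From mathcomp Require Import all_boot all_order all_algebra.
From mathcomp Require Import all_classical all_reals all_analysis.
From mathcomp Require Import measurable_realfun.
Set Implicit Arguments.
Unset Strict Implicit.
Unset Printing Implicit Defensive.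
Import Order.TTheory GRing.Theory Num.Theory.
Import numFieldNormedType.Exports.
Local Open Scope classical_set_scope.
Local Open Scope ring_scope.

(* The norm of 'cV[R]_n in the library is the max norm (it induces the usual
   topology); Euclidean norms are written norm2. *)
Definition dotv (R : realType) n (u v : 'cV[R]_n) : R :=
  \sum_(i < n) u i 0 * v i 0.

Definition norm2 (R : realType) n (v : 'cV[R]_n) : R := Num.sqrt (dotv v v).

(* R^n with its Borel sigma-algebra; convertible to 'cV[R]_n as a bare type. *)
Notation borelcV R n := (g_sigma_algebraType (@open 'cV[R]_n)).

Definition symplJ (R : realType) d : 'M[R]_(d + d) :=
  block_mx 0 1%:M (- 1%:M) 0.

Definition truncT (R : realType) n (L : R) (v : 'cV[R]_n) : 'cV[R]_n :=
  (L / Num.max (norm2 v) L) *: v.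

Definition grad (R : realType) n (f : 'cV[R]_n -> R) (x : 'cV[R]_n) :
  'cV[R]_n := \col_i 'D_(delta_mx i 0) f x.

Definition C1_on (R : realType) n (D : set 'cV[R]_n) (f : 'cV[R]_n -> R) :=
  forall x, D x -> differentiable f x /\ {for x, continuous (grad f)}.

Definition bounded_domain (R : realType) n (D : set 'cV[R]_n) :=
  [/\ open D, connected D, D !=set0 & bounded_set D].

Section Fields.
Context (R : realType) (n : nat).
Variable omega : probability (borelcV R n) R.
Variable D : set 'cV[R]_n.
Local Notation E := 'cV[R]_n.
Implicit Types (f g : E -> E) (V : set (E -> E)).

Definition L2sq g : \bar R := (\int[omega]_(x in D) (norm2 (g x) ^+ 2)%:E)%E.

Definition L2dot f g : R := (\int[omega]_(x in D) dotv (f x) (g x))%R.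

(* Squared norm of H^1_omega(D), for a function u.1 with gradient field u.2. *)
Definition H1sq (u : (E -> R) * (E -> E)) : \bar R :=
  (\int[omega]_(x in D) (u.1 x ^+ 2 + norm2 (u.2 x) ^+ 2)%:E)%E.

(* H^1_omega(D) as the completion of the C^1 functions of finite norm, which
   makes sense for every probability measure omega. Since omega may be
   singular, u.1 need not determine u.2, so that an element is a pair
   (h, nabla h), given by representatives that can be evaluated pointwise. *)
Definition sobolev1 : set ((E -> R) * (E -> E)) :=
  [set u | [/\ measurable_fun (D : set (borelcV R n)) (u.1 : borelcV R n -> R),
      measurable_fun (D : set (borelcV R n)) (u.2 : borelcV R n -> borelcV R n),
      (H1sq u < +oo)%E &
      exists f : nat -> E -> R,
        (forall m, C1_on D (f m) /\ (H1sq (f m, grad (f m)) < +oo)%E) /\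
        H1sq (f m - u.1, grad (f m) - u.2) @[m --> \oo] --> 0%E]].

Definition findim_subspace (T : lmodType R) (W : set T) :=
  exists m (b : 'I_m -> T), W = [set \sum_i c i *: b i | c in [set: 'I_m -> R]].

Definition grads (W : set ((E -> R) * (E -> E))) : set (E -> E) :=
  [set u.2 | u in W].

(* Fields are total functions, but only their values on D are relevant. *)
Definition basis_on V N (g : 'I_N -> E -> E) :=
  [/\ forall j, V (g j),
      forall c : 'I_N -> R,
        (forall x, D x -> \sum_j c j *: g j x = 0) -> forall j, c j = 0 &
      forall v, V v -> exists c : 'I_N -> R,
        forall x, D x -> v x = \sum_j c j *: g j x].

Definition orthonormal_fields N (g : 'I_N -> E -> E) :=
  forall i j, L2dot (g i) (g j) = (i == j)%:R.

Definition KN N (g : 'I_N -> E -> E) : \bar R :=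
  ereal_sup [set (\sum_j norm2 (g j x) ^+ 2)%:E | x in D].

Definition L2_projection V f p :=
  V p /\ forall v, V v -> (L2sq (f - p)%R <= L2sq (f - v)%R)%E.

Definition ls_minimizer V K (x y : 'I_K -> E) g :=
  V g /\ forall v, V v ->
    \sum_k norm2 (y k - g (x k)) ^+ 2 <= \sum_k norm2 (y k - v (x k)) ^+ 2.

End Fields.

Section Sampling.
Context (R : realType) (dO : measure_display) (Omega : measurableType dO).
Variable P : probability Omega R.

Definition mutually_independent dT (T : measurableType dT) K
    (X : 'I_K -> Omega -> T) :=
  forall (S : {set 'I_K}) (A : 'I_K -> set T),
    (forall k, measurable (A k)) ->
    P (\bigcap_(k in [set k | k \in S]) X k @^-1` A k) =
    (\prod_(k in S) P (X k @^-1` A k))%E.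

Definition iid_sample dT (T : measurableType dT) (mu : probability T R) K
    (X : 'I_K -> Omega -> T) :=
  [/\ forall k, measurable_fun setT (X k),
      forall k A, measurable A -> P (X k @^-1` A) = mu A &
      mutually_independent X].

End Sampling.

(* Main.v *)
Require Import Defs.
From HB Require Import structures.
From mathcomp Require Import all_boot all_order all_algebra.
From mathcomp Require Import all_classical all_reals all_analysis.
From mathcomp Require Import measurable_realfun.
From mathcomp Require Import ring lra.
Import Order.TTheory GRing.Theory Num.Theory.
Import numFieldNormedType.Exports.
Local Open Scope classical_set_scope.
Local Open Scope ring_scope.
Set Implicit Arguments.
Unset Strict Implicit.
Unset Printing Implicit Defensive.

(** With probability at least [1 - 2 K^-r] the empirical Gram matrix of the basis gradients
    is at least [1/2]: since [ln (3/2) <= 5/12], the lower-tail matrix Chernoff bound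
    [N exp (- K / (8 M))], with [M = lambda K / log K] bounding [K_N], is small enough.
    Its proof follows Ahlswede and Winter, with [(1 - theta S / p)^p], [p] a power of [2],
    in place of [exp (- theta S)], so that neither a matrix exponential nor the spectral
    theorem is needed: the Golden-Thompson inequality becomes
    [tr (A B)^p <= tr (A^p B^p)] up to a Trotter error [O (1 / p)].
    When the Gram matrix is bounded below, the normal equations control the distance from
    the least-squares solution to the projection by the empirical inner products of the basis
    with the residual (centered and independent, so their second moment has a factor [1 / K])
    and with the data errors. Otherwise the truncation bounds the squared error by [4 L^2]. *)

(** The expectation is taken of one explicit majorant of the squared error, valid at every sample.
    Failure of the Gram bound enters it through a nonnegative integrable function that is at least
    [1] wherever some direction violates the bound, so the failure event, an existential over
    directions, never has to be integrated. The rate comes from maximizing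
    [theta / 2 - theta ^+ 2 * M / 2], the net gain per sample when the exponential of [- theta * Q]
    is replaced by its second-order Taylor polynomial and [Q ^+ 2] by [M * Q]. The maximum is
    [1 / (8 * M)], at [theta = 1 / (2 * M)]. Exponents that are powers of [2] serve three purposes.
    Trace inequalities follow by repeated squaring. An even power of a symmetric matrix is a square,
    so its trace against a semidefinite matrix is nonnegative without any matrix square root. A
    lower bound on the quadratic form in a single direction passes to the power by squaring, without
    eigenvectors. *)

(** * Quadratic forms, semidefinite matrices and traces *)

Section QuadraticForms.
Context (R : realFieldType) (n : nat).
Implicit Types (A B C T Y : 'M[R]_n) (v : 'cV[R]_n).

Definition qform A v : R := (v^T *m A *m v) 0 0.

(** Symmetry is carried separately by [symmx]: sums and congruences preserve nonnegativity of the
    form by itself. *)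
Definition psd A := forall v, 0 <= qform A v.

Definition symmx A := A^T = A.

Lemma qform1 v : qform 1 v = \sum_i v i 0 ^+ 2.
Proof.
rewrite /qform mulmx1 mxE; apply: eq_bigr => i _.
by rewrite mxE expr2.
Qed.

Lemma qform1_ge0 v : 0 <= qform 1 v.
Proof. by rewrite qform1; apply: sumr_ge0 => i _; exact: sqr_ge0. Qed.

Lemma qform1_gt0 v : v != 0 -> 0 < qform 1 v.
Proof.
move=> v0; rewrite lt_def qform1_ge0 andbT; apply: contra v0.
rewrite qform1 psumr_eq0; last by move=> i _; exact: sqr_ge0.
move=> /allP v0; apply/eqP/matrixP => i j; rewrite (ord1 j) mxE.
by have := v0 i (mem_index_enum _); rewrite sqrf_eq0 => /eqP.
Qed.

Lemma qformD A B v : qform (A + B) v = qform A v + qform B v.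
Proof. by rewrite /qform mulmxDr mulmxDl mxE. Qed.

Lemma qformZ a A v : qform (a *: A) v = a * qform A v.
Proof. by rewrite /qform -scalemxAr -scalemxAl mxE. Qed.

Lemma qformN A v : qform (- A) v = - qform A v.
Proof. by rewrite -scaleN1r qformZ mulN1r. Qed.

Lemma qform0 v : qform 0 v = 0.
Proof. by rewrite /qform mulmx0 mul0mx mxE. Qed.

Lemma qform_conj A B v : qform (B^T * A * B) v = qform A (B *m v).
Proof. by rewrite /qform -!mulmxE trmx_mul !mulmxA. Qed.

Lemma qform_sqr B v : qform (B^T * B) v = qform 1 (B *m v).
Proof. by rewrite -qform_conj mulr1. Qed.

Lemma psdD A B : psd A -> psd B -> psd (A + B).
Proof. by move=> hA hB v; rewrite qformD addr_ge0. Qed.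

Lemma psdZ a A : 0 <= a -> psd A -> psd (a *: A).
Proof. by move=> a0 hA v; rewrite qformZ mulr_ge0. Qed.

Lemma psd0 : psd 0.
Proof. by move=> v; rewrite qform0. Qed.

Lemma psd_conj A B : psd A -> psd (B^T * A * B).
Proof. by move=> hA v; rewrite qform_conj. Qed.

Lemma symmxD A B : symmx A -> symmx B -> symmx (A + B).
Proof. by rewrite /symmx linearD /= => -> ->. Qed.

Lemma symmxZ a A : symmx A -> symmx (a *: A).
Proof. by rewrite /symmx linearZ /= => ->. Qed.

Lemma symmx1 : symmx 1.
Proof. exact: trmx1. Qed.

Lemma symmx1B A : symmx A -> symmx (1 - A).
Proof. by move=> hA; apply: symmxD symmx1 _; rewrite -scaleN1r; apply: symmxZ. Qed.

Lemma symmx_sum (I : Type) (s : seq I) (P : pred I) (F : I -> 'M[R]_n) :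
  (forall i, P i -> symmx (F i)) -> symmx (\sum_(i <- s | P i) F i).
Proof. by move=> h; elim/big_ind: _ => //; [exact: trmx0|exact: symmxD]. Qed.

Lemma trmxX A k : (A ^+ k)^T = A^T ^+ k.
Proof.
elim: k => [|k IH]; first by rewrite !expr0 trmx1.
by rewrite exprS exprSr -IH -!mulmxE trmx_mul.
Qed.

Lemma symmxX A k : symmx A -> symmx (A ^+ k).
Proof. by rewrite /symmx trmxX => ->. Qed.

Lemma mxtrace_gram Y : \tr (Y * Y^T) = \sum_i \sum_j Y i j ^+ 2.
Proof.
apply: eq_bigr => i _; rewrite -mulmxE mxE; apply: eq_bigr => j _.
by rewrite mxE expr2.
Qed.

Lemma mxtrace_gram_ge0 Y : 0 <= \tr (Y * Y^T).
Proof.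
by rewrite mxtrace_gram; do 2! (apply: sumr_ge0 => ? _); exact: sqr_ge0.
Qed.

Lemma mxtrace_mulrC A B : \tr (A * B) = \tr (B * A).
Proof. by rewrite -!mulmxE mxtrace_mulC. Qed.

Lemma mxtrace_mul_le A B : \tr (A * B^T) <= (\tr (A * A^T) + \tr (B * B^T)) / 2.
Proof.
have := mxtrace_gram_ge0 (A - B).
rewrite linearB /= mulrBl !mulrBr !linearB /= -[\tr (B * A^T)]mxtrace_tr.
rewrite -[(B * A^T)^T]/((B *m A^T)^T) trmx_mul trmxK mulmxE; lra.
Qed.

Lemma mxtrace_psd A : psd A -> 0 <= \tr A.
Proof.
move=> hA; apply: sumr_ge0 => i _; have := hA (delta_mx i 0).
by rewrite /qform trmx_delta -rowE -colE !mxE.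
Qed.

(** By cyclicity the trace is that of the congruence [B^T * A * B]. This stands in for the
    nonnegative trace of a product of two semidefinite matrices, one of which is here an explicit
    square. *)
Lemma mxtrace_sqr_psd A B : symmx B -> psd A -> 0 <= \tr (B ^+ 2 * A).
Proof.
move=> sB hA; rewrite expr2 -mulrA mxtrace_mulrC -{1}sB.
by apply: mxtrace_psd; apply: psd_conj.
Qed.

End QuadraticForms.

(** * Trace inequality for powers of a product of symmetric matrices *)

Section GoldenThompson.
Context (R : realFieldType) (n : nat).
Implicit Types (A B Y : 'M[R]_n).

Lemma mxtrace_mulXC A B k : \tr ((A * B) ^+ k) = \tr ((B * A) ^+ k).
Proof.
case: k => [|k]; first by rewrite !expr0.
have h : (A * B) ^+ k.+1 = A * ((B * A) ^+ k * B).
  elim: k => [|k IH]; first by rewrite expr0 mul1r expr1.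
  by rewrite exprS IH exprS !mulrA.
by rewrite h mxtrace_mulrC -mulrA -exprSr.
Qed.

(* The two bounds are proved together: the second one for [Y ^+ 2] reduces to the first one
   for [Y^T * Y] and [Y * Y^T], and the first one for [2 ^ k.+1] to the second for [A * B]. *)
Lemma mxtrace_prod_powers (k : nat) :
  (forall A B, symmx A -> symmx B ->
    \tr ((A * B) ^+ (2 ^ k)) <= \tr (A ^+ (2 ^ k) * B ^+ (2 ^ k))) /\
  (forall Y, \tr (Y ^+ (2 ^ k.+1)) <= \tr ((Y * Y^T) ^+ (2 ^ k))).
Proof.
elim: k => [|k [IHprod IHgram]].
  split=> [A B _ _|Y]; first by rewrite expn0 !expr1.
  rewrite expn0 expn1 expr1 expr2.
  have := mxtrace_mul_le Y Y^T.
  by rewrite trmxK (mxtrace_mulrC Y^T) => /le_trans; apply;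
    rewrite -mulr2n -[_ *+ 2]mulr_natr mulfK ?pnatr_eq0.
have gram Y : \tr (Y ^+ (2 ^ k.+2)) <= \tr ((Y * Y^T) ^+ (2 ^ k.+1)).
  rewrite expnS exprM; apply: (le_trans (IHgram _)).
  have -> : \tr ((Y ^+ 2 * (Y ^+ 2)^T) ^+ (2 ^ k)) =
      \tr (((Y^T * Y) * (Y * Y^T)) ^+ (2 ^ k)).
    rewrite trmxX !expr2.
    by rewrite mulrA (mxtrace_mulXC _ Y^T) !mulrA.
  have sP : symmx (Y^T * Y).
    by rewrite /symmx -mulmxE trmx_mul trmxK.
  have sQ : symmx (Y * Y^T).
    by rewrite /symmx -mulmxE trmx_mul trmxK.
  apply: (le_trans (IHprod _ _ sP sQ)).
  (* The mixed trace is at most the mean of the traces of the same power of [Y^T * Y] and of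
     [Y * Y^T], and these two agree by cyclicity. *)
  rewrite -{1}(symmxX (2 ^ k) sQ).
  apply: (le_trans (mxtrace_mul_le _ _)).
  rewrite !symmxX // -!exprD addnn -mul2n -expnS (mxtrace_mulXC Y^T).
  by rewrite -mulr2n -[_ *+ 2]mulr_natr mulfK ?pnatr_eq0.
split=> // A B sA sB; apply: (le_trans (IHgram _)).
rewrite -[(A * B)^T]/((A *m B)^T) trmx_mul sA sB mulmxE.
rewrite mxtrace_mulXC; have -> : B * A * (A * B) = B * (A ^+ 2 * B) by rewrite expr2 !mulrA.
rewrite mxtrace_mulXC -mulrA -expr2 expnS !exprM.
by apply: IHprod; apply: symmxX.
Qed.

End GoldenThompson.

(** * Bounds on matrix powers and the trace estimate for one added summand *)

Lemma sum_Cauchy_Schwarz (R : realFieldType) (I : finType) (a b : I -> R) :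
  (\sum_i a i * b i) ^+ 2 <= (\sum_i a i ^+ 2) * (\sum_i b i ^+ 2).
Proof.
set S := \sum_i a i ^+ 2; set T := \sum_i b i ^+ 2; set P := \sum_i _.
have T0 : 0 <= T by apply: sumr_ge0 => i _; exact: sqr_ge0.
have : 0 <= \sum_i (T * a i - P * b i) ^+ 2.
  by apply: sumr_ge0 => i _; exact: sqr_ge0.
rewrite (eq_bigr (fun i => T ^+ 2 * a i ^+ 2 +
  (- 2 * T * P) * (a i * b i) + P ^+ 2 * b i ^+ 2)); last by move=> i _; ring.
rewrite !big_split /= -!mulr_sumr -/S -/T -/P.
have -> : T ^+ 2 * S + - 2 * T * P * P + P ^+ 2 * T = T * (S * T - P ^+ 2).
  by ring.
have [T_eq0|T_neq0] := eqVneq T 0; last first.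
  by rewrite pmulr_rge0 ?subr_ge0 // lt_def T_neq0.
move=> _; suff -> : P = 0 by rewrite T_eq0 mulr0 expr0n.
apply: big1 => i _; move/eqP: T_eq0.
rewrite psumr_eq0; last by move=> j _; exact: sqr_ge0.
by move=> /allP /(_ i (mem_index_enum _)); rewrite sqrf_eq0 => /eqP ->; rewrite mulr0.
Qed.

Section PowerBounds.
Context (R : realFieldType) (n : nat).
Implicit Types (A B T X : 'M[R]_n) (v : 'cV[R]_n).

(** With [C] and [g] the current powers of [B] and [beta], expanding the squared length of
    [(C - g) *m v] bounds the form of [C ^+ 2] below by [2 * g] times that of [C] minus [g ^+ 2]
    times that of [1], so one squaring step stays in the direction [v]. *)
Lemma qform_expr_pow2 B v (beta : R) k : symmx B -> 0 <= beta ->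
  beta * qform 1 v <= qform B v ->
  beta ^+ (2 ^ k) * qform 1 v <= qform (B ^+ (2 ^ k)) v.
Proof.
move=> sB b0 hB; elim: k => [|k IH]; first by rewrite expn0 !expr1.
rewrite expnSr !exprM; set C := B ^+ (2 ^ k) in IH *.
set g := beta ^+ (2 ^ k) in IH *.
have g0 : 0 <= g by exact: exprn_ge0.
have sC : symmx C by exact: symmxX.
have := qform1_ge0 ((C - g *: (1 : 'M[R]_n)) *m v).
rewrite -qform_sqr.
have -> : (C - g *: (1 : 'M[R]_n))^T * (C - g *: (1 : 'M[R]_n)) =
    C ^+ 2 + (- 2 * g) *: C + (g ^+ 2) *: (1 : 'M[R]_n).
  rewrite linearB linearZ /= sC symmx1 mulrBl !mulrBr -!mulmxE.
  rewrite -!scalemxAl -!scalemxAr !mulmxE !mul1r !mulr1 scalerA.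
  have -> : (- 2 * g) *: C = - (g *: C) - g *: C.
    by rewrite -scaleNr -scalerDl; congr (_ *: _); ring.
  by rewrite opprB !addrA -!expr2 [RHS]addrAC.
rewrite !qformD !qformZ => h; have := ler_wpM2l g0 IH.
by move: h; rewrite !expr2; move: (qform _ _) (qform _ _) (qform _ _) => x y z; lra.
Qed.

Lemma qform_gram_le B v : qform (B^T * B) v <= \tr (B * B^T) * qform 1 v.
Proof.
rewrite qform_sqr mxtrace_gram !qform1 mulr_suml; apply: ler_sum => i _.
by rewrite mxE; exact: sum_Cauchy_Schwarz.
Qed.

(** One direction in which [B] is at least [beta] is detected by the trace of a power, a task
    usually given to the largest eigenvalue. The exponent is even, so the power is the Gram matrix
    of the half power and its form is bounded by the squared Frobenius norm. *)
Lemma mxtrace_expr_pow2_ge B v (beta : R) k : symmx B -> 0 <= beta ->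
  v != 0 -> beta * qform 1 v <= qform B v ->
  beta ^+ (2 ^ k.+1) <= \tr (B ^+ (2 ^ k.+1)).
Proof.
move=> sB b0 v0 hB.
rewrite -(ler_pM2r (qform1_gt0 v0)); apply: (le_trans (qform_expr_pow2 _ sB b0 hB)).
rewrite expnSr exprM expr2 -{1 3}(symmxX (2 ^ k) sB) -{2}(symmxX (2 ^ k) sB).
have := qform_gram_le (B ^+ (2 ^ k)) v.
by rewrite !(symmxX (2 ^ k) sB).
Qed.

(** The hypothesis on [T - T ^+ 2] encodes that [T] is at most [1]. With [U = 1 - T], the gap for
    [p.+1] is the gap for [p] times [U] plus ['C(p, 2)] times [T ^+ 3]. The induction therefore
    carries an arbitrary factor [U ^+ i]. The product [T ^+ 3 * U ^+ i] is semidefinite by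
    congruence: of [T ^+ 3] for even [i], of [T - T ^+ 2] for odd [i]. *)
Lemma psd_expr_taylor2 T p : symmx T -> psd T -> psd (T - T ^+ 2) ->
  psd (1 - p%:R *: T + 'C(p, 2)%:R *: T ^+ 2 - (1 - T) ^+ p).
Proof.
move=> sT pT pT2.
set U := 1 - T.
have cTU i j : U ^+ i * T ^+ j = T ^+ j * U ^+ i.
  by apply: commrX; apply: commr_sym; apply: commrX; apply: commrB; [exact: commr1|].
have sU i : symmx (U ^+ i) by exact/symmxX/symmx1B.
have cub i : psd (T ^+ 3 * U ^+ i).
  have split_half A m : U ^+ m * A = A * U ^+ m -> psd A -> psd (A * U ^+ (m + m)).
    move=> cA pA; rewrite exprD mulrA -cA -{1}(sU m); exact: psd_conj.
  have pT3 : psd (T ^+ 3).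
    by rewrite !exprS expr0 mulr1 mulrA -{1}sT; exact: psd_conj.
  rewrite -(odd_double_half i) -addnn; case: (odd i); last exact: split_half.
  rewrite exprD expr1 mulrA; apply: split_half.
    by rewrite mulrA cTU -!mulrA -exprS -exprSr.
  have -> : T ^+ 3 * U = T^T * (T - T ^+ 2) * T.
    by rewrite sT /U !mulrBr mulrBl !exprS expr0 !mulr1 !mulrA.
  exact: psd_conj.
suff h i : psd ((1 - p%:R *: T + 'C(p, 2)%:R *: T ^+ 2 - U ^+ p) * U ^+ i).
  by have := h 0%N; rewrite expr0 mulr1.
elim: p i => [|p IH] i.
  by rewrite bin0n !scale0r subr0 addr0 expr0 subrr mul0r; exact: psd0.
suff -> : 1 - p.+1%:R *: T + 'C(p.+1, 2)%:R *: T ^+ 2 - U ^+ p.+1 =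
    (1 - p%:R *: T + 'C(p, 2)%:R *: T ^+ 2 - U ^+ p) * U + 'C(p, 2)%:R *: T ^+ 3.
  rewrite mulrDl -mulrA -exprS; apply: psdD; first exact: IH.
  by rewrite -mulmxE -scalemxAl mulmxE; apply: psdZ => //; exact: ler0n.
rewrite [in RHS]mulrBl -exprSr [RHS]addrAC; congr (_ - _).
rewrite /U mulrBr mulr1 !mulrDl mul1r mulNr -!mulmxE -!scalemxAl !mulmxE.
rewrite -exprSr -expr2 binS bin1 natrD -natr1 !scalerDl scale1r.
rewrite !opprD opprK !addrA subrK; congr (_ + _).
by rewrite addrAC.
Qed.

(** The entrywise l1 norm is submultiplicative and dominates the trace. It serves only for the
    Trotter error, where dimension factors are harmless because [p] is chosen last. *)
Definition mxl1 A : R := \sum_i \sum_j `|A i j|.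

Lemma mxl1_ge0 A : 0 <= mxl1 A.
Proof. by do 2! (apply: sumr_ge0 => ? _). Qed.

Lemma mxl1D A B : mxl1 (A + B) <= mxl1 A + mxl1 B.
Proof.
rewrite -big_split; apply: ler_sum => i _; rewrite -big_split.
by apply: ler_sum => j _; rewrite mxE ler_normD.
Qed.

Lemma mxl1Z a A : mxl1 (a *: A) = `|a| * mxl1 A.
Proof.
rewrite mulr_sumr; apply: eq_bigr => i _; rewrite mulr_sumr.
by apply: eq_bigr => j _; rewrite mxE normrM.
Qed.

Lemma mxl1M A B : mxl1 (A * B) <= mxl1 A * mxl1 B.
Proof.
apply: (@le_trans _ _ (\sum_i \sum_k \sum_j (`|A i j| * `|B j k|))).
  apply: ler_sum => i _; apply: ler_sum => k _; rewrite -mulmxE mxE.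
  by apply: (le_trans (ler_norm_sum _ _ _)); apply: ler_sum => j _; rewrite normrM.
rewrite mulr_suml; apply: ler_sum => i _; rewrite exchange_big mulr_suml.
apply: ler_sum => j _; rewrite -mulr_sumr; apply: ler_wpM2l => //.
by rewrite /mxl1 [leRHS](bigD1 j) //= lerDl; do 2! (apply: sumr_ge0 => ? _).
Qed.

Lemma mxl1_1 : mxl1 1 = n%:R.
Proof.
rewrite -[n in RHS]card_ord -sumr_const; apply: eq_bigr => i _.
rewrite (bigD1 i) //= big1 ?addr0; first by rewrite mxE eqxx normr1.
by move=> j; rewrite mxE eq_sym => /negbTE ->; rewrite normr0.
Qed.

Lemma mxtrace_le_mxl1 A : \tr A <= mxl1 A.
Proof.
apply: ler_sum => i _; rewrite [leRHS](bigD1 i) //=.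
by rewrite (le_trans (ler_norm _)) // lerDl; apply: sumr_ge0.
Qed.

Lemma mxl1_1DX A e k : mxl1 A <= e -> mxl1 ((1 + A) ^+ k) <= n%:R * (1 + e) ^+ k.
Proof.
move=> he; have e0 := le_trans (mxl1_ge0 A) he.
elim: k => [|k IH]; first by rewrite !expr0 mxl1_1 mulr1.
rewrite !exprSr mulrDr mulr1; apply: (le_trans (mxl1D _ _)).
rewrite mulrA mulrDr mulr1; apply: lerD => //.
by apply: (le_trans (mxl1M _ _)); apply: ler_pM; rewrite ?mxl1_ge0.
Qed.

(** Telescoping: each exponent adds one term [(1 + B) ^+ k * (A - B)]. The factor [n] is the norm of
    the identity. *)
Lemma mxl1_expr1DB A B e (del : R) k : mxl1 A <= e -> mxl1 B <= e ->
  mxl1 (A - B) <= del ->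
  mxl1 ((1 + A) ^+ k - (1 + B) ^+ k) <= k%:R * n%:R * (1 + e) ^+ k * del.
Proof.
move=> hA hB hd; have e0 := le_trans (mxl1_ge0 A) hA.
have d0 := le_trans (mxl1_ge0 _) hd.
elim: k => [|k IH].
  by rewrite !expr0 subrr !mul0r -(scale0r (0 : 'M[R]_n)) mxl1Z normr0 mul0r.
have -> : (1 + A) ^+ k.+1 - (1 + B) ^+ k.+1 =
    ((1 + A) ^+ k - (1 + B) ^+ k) * (1 + A) + (1 + B) ^+ k * (A - B).
  have -> : A - B = (1 + A) - (1 + B) by rewrite opprD addrACA subrr add0r.
  by rewrite mulrBl mulrBr -!exprSr addrA subrK.
apply: (le_trans (mxl1D _ _)).
have -> : k.+1%:R * n%:R * (1 + e) ^+ k.+1 * del =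
   k%:R * n%:R * (1 + e) ^+ k * del * (1 + e) + n%:R * (1 + e) ^+ k * (1 + e) * del.
  by rewrite -natr1 exprSr; ring.
apply: lerD.
  rewrite !mulrDr !mulr1.
  apply: (le_trans (mxl1D _ _)); apply: lerD => //.
  by apply: (le_trans (mxl1M _ _)); apply: ler_pM; rewrite ?mxl1_ge0.
apply: (le_trans (mxl1M _ _)); apply: ler_pM; rewrite ?mxl1_ge0 //.
apply: (le_trans (mxl1_1DX _ hB)); rewrite ler_peMr ?lerDl //.
by rewrite mulr_ge0 // exprn_ge0 // addr_ge0.
Qed.

(* Golden-Thompson splits the trace; the last summand is the Trotter error, of order [1 / p]
   when [eta] is. The factor [(1 - eta *: X) ^+ p] is bounded by its second-order Taylor
   polynomial. *)
Lemma mxtrace_step A X (eta M a th : R) k p :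
  symmx A -> symmx X -> psd X -> psd (M *: X - X ^+ 2) -> 0 <= M ->
  0 <= eta -> eta * M <= 1 -> mxl1 A <= a -> mxl1 X <= a -> eta * a <= 1 ->
  p = (2 ^ k.+1)%N -> th = p%:R * eta ->
  \tr ((1 - eta *: (A + X)) ^+ p) <=
  \tr ((1 - eta *: A) ^+ p * (1 - (th - th ^+ 2 * M / 2) *: X)) +
  p%:R * n%:R * (1 + 3 * (eta * a)) ^+ p * (eta * a) ^+ 2.
Proof.
move=> sA sX pX pX2 M0 eta0 etaM hA hX etaa pE thE.
have a0 := le_trans (mxl1_ge0 A) hA.
set B := 1 - eta *: A; set C := 1 - eta *: X.
have sB : symmx B by exact/symmx1B/symmxZ.
have sC : symmx C by exact/symmx1B/symmxZ.
have BC : \tr ((B * C) ^+ p) <= \tr (B ^+ p * C ^+ p).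
  by rewrite pE; have [+ _] := mxtrace_prod_powers R n k.+1; apply.
have XX2 : (eta *: X) ^+ 2 = eta ^+ 2 *: X ^+ 2.
  by rewrite !expr2 -!mulmxE -scalemxAl -scalemxAr scalerA.
have CX : \tr (B ^+ p * C ^+ p) <= \tr (B ^+ p * (1 - (th - th ^+ 2 * M / 2) *: X)).
  rewrite -subr_ge0 -linearB -mulrBr pE expnSr exprM.
  apply: mxtrace_sqr_psd; first exact: symmxX.
  rewrite -expnSr -pE.
  (* Three semidefinite gaps: the Taylor remainder for [eta *: X], the replacement of [X ^+ 2] by
     [M *: X], and the replacement of ['C(p, 2)] by [p ^ 2 / 2]. *)
  have -> : 1 - (th - th ^+ 2 * M / 2) *: X - C ^+ p =
    (1 - p%:R *: (eta *: X) + 'C(p, 2)%:R *: (eta *: X) ^+ 2 - (1 - eta *: X) ^+ p) +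
    ('C(p, 2)%:R * eta ^+ 2) *: (M *: X - X ^+ 2) +
    (eta ^+ 2 * M * (p%:R ^+ 2 / 2 - 'C(p, 2)%:R)) *: X.
    rewrite -/C XX2 thE.
    move: (C ^+ p) (X ^+ 2) (1 : 'M[R]_n) => Z Y I.
    by apply/matrixP => i j; rewrite !mxE; field.
  apply: psdD; first apply: psdD.
  - apply: psd_expr_taylor2; [exact: symmxZ|exact: psdZ|rewrite XX2].
    have -> : eta *: X - eta ^+ 2 *: X ^+ 2 =
        (eta * (1 - eta * M)) *: X + eta ^+ 2 *: (M *: X - X ^+ 2).
      by move: (X ^+ 2) => Y; apply/matrixP => i j; rewrite !mxE; ring.
    by apply: psdD; apply: psdZ; rewrite ?sqr_ge0 ?mulr_ge0 ?subr_ge0.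
  - by apply: psdZ; rewrite // mulr_ge0 ?sqr_ge0.
  apply: psdZ => //; rewrite mulr_ge0 // ?mulr_ge0 ?sqr_ge0 // subr_ge0.
  rewrite ler_pdivlMr // -natrX -natrM ler_nat bin2 muln2.
  apply: (@leq_trans (p * p.-1)); last by rewrite -mulnn leq_mul2l leq_pred orbT.
  by rewrite -[leqRHS]odd_double_half leq_addl.
apply: (@le_trans _ _ (\tr ((B * C) ^+ p) +
    \tr ((1 - eta *: (A + X)) ^+ p - (B * C) ^+ p))).
  by rewrite linearB /= addrCA subrr addr0.
apply: lerD; first exact: le_trans BC CX.
apply: (le_trans (mxtrace_le_mxl1 _)).
(* The two bases differ only by [eta ^+ 2 *: (A * X)], whence the factor [(eta * a) ^+ 2]; both
   perturbations of [1] have norm at most [3 * (eta * a)]. *)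
have -> : B * C = 1 + (eta ^+ 2 *: (A * X) - eta *: (A + X)).
  rewrite /B /C mulrBr mulr1 mulrBl mul1r -!mulmxE -scalemxAl -scalemxAr scalerA mulmxE.
  move: (A * X) (1 : 'M[R]_n) => Y I.
  by apply/matrixP => i j; rewrite !mxE; ring.
have ea0 : 0 <= eta * a by rewrite mulr_ge0.
have AX : mxl1 (- (eta *: (A + X))) <= 2 * (eta * a).
  rewrite -scaleNr mxl1Z normrN ger0_norm // mulrCA.
  apply: ler_wpM2l => //; apply: (le_trans (mxl1D _ _)); lra.
have AX2 : mxl1 (eta ^+ 2 *: (A * X)) <= (eta * a) ^+ 2.
  rewrite mxl1Z ger0_norm ?sqr_ge0 // exprMn; apply: ler_wpM2l; first exact: sqr_ge0.
  by rewrite expr2 (le_trans (mxl1M _ _)) // ler_pM ?mxl1_ge0.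
have ea2 : (eta * a) ^+ 2 <= eta * a by rewrite expr2 ler_piMr.
apply: mxl1_expr1DB; first by apply: (le_trans AX); lra.
  by apply: (le_trans (mxl1D _ _)); lra.
by rewrite opprB addKr -scaleN1r mxl1Z normrN1 mul1r.
Qed.

End PowerBounds.

(** * Expectation of a product of two independent variables *)

Section IndependentProduct.
Context (R : realType) (dO : measure_display) (Omega : measurableType dO).
Variable P : probability Omega R.

(** Independence identifies the law of the pair with the product of the laws, by uniqueness on
    rectangles; Fubini then separates the two factors. *)
Lemma Rintegral_independentM (Y Z : Omega -> R) :
  (forall A B, measurable A -> measurable B ->
    P (Y @^-1` A `&` Z @^-1` B) = (P (Y @^-1` A) * P (Z @^-1` B))%E) ->
  measurable_fun setT Y -> measurable_fun setT Z ->
  P.-integrable setT (EFin \o Y) -> P.-integrable setT (EFin \o Z) ->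
  P.-integrable setT (fun w => (Y w * Z w)%:E) ->
  \int[P]_w (Y w * Z w) = (\int[P]_w Y w) * (\int[P]_w Z w).
Proof.
move=> ind mY mZ iY iZ iYZ.
pose Y' : {mfun Omega >-> R} := mfun_Sub (mem_set mY).
pose Z' : {mfun Omega >-> R} := mfun_Sub (mem_set mZ).
have mYZ : measurable_fun setT (fun w => (Y w, Z w)) by exact: measurable_fun_pair.
pose W : {mfun Omega >-> (R * R)%type} := mfun_Sub (mem_set mYZ).
pose f (z : (R * R)%type) : \bar R := (z.1 * z.2)%:E.
have mf : measurable_fun setT f.
  by apply/measurable_EFinP; apply: measurable_funM;
    [exact: measurable_fst|exact: measurable_snd].
have prodE X : measurable X ->
    (distribution P Y' \x distribution P Z')%E X = distribution P W X.
  by apply: product_measure_unique => A B mA mB; exact: ind.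
have prodI g : (\int[distribution P Y' \x distribution P Z']_z g z =
    \int[distribution P W]_z g z)%E.
  by apply: eq_measure_integral => A mA _; exact: prodE.
have ifW : (distribution P W).-integrable setT f.
  apply/integrableP; split => //.
  have [_] := integrableP _ _ _ iYZ.
  rewrite ge0_integral_distribution //; exact: measurableT_comp.
have ifp : (distribution P Y' \x distribution P Z')%E.-integrable setT f.
  apply/integrableP; split => //.
  have [_] := integrableP _ _ _ ifW.
  by rewrite -prodI.
have iY' : (distribution P Y').-integrable setT EFin.
  apply/integrableP; split; first exact/measurable_EFinP.
  have [_] := integrableP _ _ _ iY.
  by rewrite ge0_integral_distribution //; exact/measurableT_comp/measurable_EFinP.
have iZ' : (distribution P Z').-integrable setT EFin.
  apply/integrableP; split; first exact/measurable_EFinP.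
  have [_] := integrableP _ _ _ iZ.
  by rewrite ge0_integral_distribution //; exact/measurableT_comp/measurable_EFinP.
rewrite /Rintegral.
have -> : (\int[P]_w (Y w * Z w)%:E = \int[distribution P W]_z f z)%E.
  by rewrite integral_distribution.
rewrite -prodI -(integral12_prod_meas1 ifp) /fubini_F /f /=.
have -> : (\int[P]_w (Y w)%:E = \int[distribution P Y']_y y%:E)%E.
  by rewrite integral_distribution //; exact/measurable_EFinP.
have EZ : (\int[P]_w (Z w)%:E = \int[distribution P Z']_y y%:E)%E.
  by rewrite integral_distribution //; exact/measurable_EFinP.
rewrite EZ; under eq_integral do [under eq_integral do rewrite EFinM; rewrite integralZl //].
have fZ := integrable_fin_num measurableT iZ'.
rewrite -(fineK fZ); under eq_integral do rewrite muleC.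
rewrite integralZl // muleC fineM //.
exact: integrable_fin_num.
Qed.

End IndependentProduct.

(** * The sigma-algebra generated by part of the sample *)

Section History.
Context (R : realType) (dO : measure_display) (Omega : measurableType dO).
Context (dT : measure_display) (T : measurableType dT) (K : nat).
Variables (P : probability Omega R) (X : 'I_K -> Omega -> T).
Hypothesis mX : forall k, measurable_fun setT (X k).
Hypothesis indX : mutually_independent P X.

(** A pi-system generating the sigma-algebra of the sample points indexed by [S]; its members have
    the shape that [mutually_independent] speaks about. *)
Definition cylinders (S : {set 'I_K}) : set (set Omega) :=
  [set B | exists A : 'I_K -> set T, (forall k, measurable (A k)) /\
    B = \bigcap_(k in [set k | k \in S]) X k @^-1` A k].

Lemma cylinders_measurable S : cylinders S `<=` measurable.
Proof.
move=> _ [A [mA ->]]; apply: fin_bigcap_measurable => // k _.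
by rewrite -[X in measurable X]setTI; exact: mX.
Qed.

Lemma cylinders_setI_closed S : setI_closed (cylinders S).
Proof.
move=> _ _ [A [mA ->]] [B [mB ->]]; exists (fun k => A k `&` B k); split.
  by move=> k; exact: measurableI.
by rewrite bigcapI.
Qed.

Lemma cylinders_setT S : cylinders S setT.
Proof.
exists (fun=> setT); split => //.
by apply/esym; rewrite -subTset => w _ k _.
Qed.

(** With [C] the event of [X k], the finite measures sending [B] to [P (B] intersected with [C)] and
    to [P C * P B] agree on the cylinders, hence on the sigma-algebra they generate. Agreement on a
    cylinder is independence over [k |: S], with [A] inserted at index [k]. *)
Lemma cylinders_independent (S : {set _}) k B A : k \notin S -> <<s cylinders S >> B ->
  measurable A -> P (B `&` X k @^-1` A) = (P B * P (X k @^-1` A))%E.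
Proof.
move=> kS sB mA; set C := X k @^-1` A.
have mC : measurable C by rewrite -[X in measurable X]setTI; exact: mX.
have fC : P C \is a fin_num by exact: fin_num_measure.
pose c : {nonneg R} := NngNum (fine_ge0 (measure_ge0 P C)).
rewrite muleC -(fineK fC).
apply: (g_sigma_algebra_measure_unique (cylinders S)
  (cylinders_measurable (S := S)) (fun=> setT) _ _ (mrestr P mC) (mscale c P)) => //.
- by move=> _; exact: cylinders_setT.
- by rewrite bigcup_const.
- exact: cylinders_setI_closed.
- move=> _ [F [mF ->]]; rewrite /mrestr /mscale /=.
  pose F' i := if i == k then A else F i.
  have mF' i : measurable (F' i) by rewrite /F'; case: ifP.
  have FF' i : i \in S -> F' i = F i.
    by move=> iS; rewrite /F'; case: eqP => // ik; move: kS; rewrite -ik iS.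
  have FC : \bigcap_(i in [set i | i \in S]) X i @^-1` F i `&` C =
      \bigcap_(i in [set i | i \in k |: S]) X i @^-1` F' i.
    apply/seteqP; split => [w [h1 h2] i /=|w h].
      rewrite in_setU1 => /orP[/eqP ->|iS]; first by rewrite /F' eqxx.
      by rewrite FF' //; exact: h1.
    split; last by have := h k (setU11 _ _); rewrite /F' eqxx.
    by move=> i /= iS; rewrite -FF' //; apply: h; rewrite /= in_setU1 iS orbT.
  transitivity (P C * \prod_(i in S) P (X i @^-1` F i))%E; last first.
    by rewrite /mscale /=; congr (_ * _)%E; [exact/esym/fineK|exact/esym/(indX S mF)].
  rewrite [LHS](congr1 P FC) (indX _ mF') big_setU1 //= {1}/F' eqxx.
  by congr (_ * _)%E; apply: eq_bigr => i iS; rewrite FF'.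
- by move=> _; rewrite /mrestr (le_lt_trans (probability_le1 _ _)) ?ltry //; exact: measurableI.
Qed.

(** The sub-sigma-algebra is imposed by changing the structure on the source, so the closure
    properties of measurable functions apply verbatim. *)
Definition hist_measurable (S : {set _}) (Y : Omega -> R) :=
  measurable_fun setT (Y : g_sigma_algebraType (cylinders S) -> R).

Lemma hist_measurable_fun S Y : hist_measurable S Y -> measurable_fun setT Y.
Proof.
move=> hY _ A mA; have := hY measurableT A mA.
by apply: smallest_sub; [exact: sigma_algebra_measurable|exact: cylinders_measurable].
Qed.

Lemma hist_measurable_comp (S : {set _}) k (Z : T -> R) : k \in S -> measurable_fun setT Z ->
  hist_measurable S (Z \o X k).
Proof.
move=> kS mZ _ A mA; apply: sub_sigma_algebra.
exists (fun i => if i == k then Z @^-1` A else setT); split.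
  by move=> i; case: eqP => // _; rewrite -[X in measurable X]setTI; exact: mZ.
rewrite setTI; apply/seteqP; split => [w hw i _|w /(_ k kS)] /=; last by rewrite eqxx.
by case: eqP => // ->.
Qed.

Lemma Rintegral_histM (S : {set _}) k (Y : Omega -> R) (Z : T -> R) : k \notin S ->
  hist_measurable S Y -> measurable_fun setT Z ->
  P.-integrable setT (EFin \o Y) -> P.-integrable setT (EFin \o (Z \o X k)) ->
  P.-integrable setT (fun w => (Y w * Z (X k w))%:E) ->
  \int[P]_w (Y w * Z (X k w)) = (\int[P]_w Y w) * (\int[P]_w Z (X k w)).
Proof.
move=> kS hY mZ iY iZ iYZ; apply: Rintegral_independentM => //.
- move=> A B mA mB; apply: (@cylinders_independent S k (Y @^-1` A) (Z @^-1` B) kS).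
    by rewrite -[X in <<s _ >> X]setTI; exact: hY.
  by rewrite -[X in measurable X]setTI; exact: mZ.
- exact: hist_measurable_fun hY.
- exact: measurableT_comp.
Qed.

End History.

(** * Finite sums of integrals; bounded functions of part of the sample *)

Lemma bounded_measurable_integrable (R : realType) (d : measure_display)
    (T : measurableType d) (P : probability T R) (Y : T -> R) :
  measurable_fun setT Y -> (exists C, forall w, `|Y w| <= C) ->
  P.-integrable setT (EFin \o Y).
Proof.
move=> mY [C hC]; apply: measurable_bounded_integrable => //.
  exact: le_lt_trans (probability_le1 P measurableT) (ltry 1).
exists `|C|; split => // x Cx w _ /=.
by rewrite (le_trans (hC w)) // (le_trans (ler_norm C)) // ltW.
Qed.

Lemma Rintegral_cst_probability (R : realType) (d : measure_display)
    (T : measurableType d) (P : probability T R) (c : R) : \int[P]_w c = c.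
Proof.
rewrite Rintegral_cst // (_ : fine (P setT) = 1) ?mulr1 //.
by have -> : P setT = 1%E by exact: probability_setT.
Qed.

Section RintegralSum.
Context (R : realType) (d : measure_display) (T : measurableType d).
Variables (mu : {measure set T -> \bar R}).

Lemma integrable_EFin_sum (D : set T) (I : Type) (s : seq I) (f : I -> T -> R) :
  measurable D -> (forall i, mu.-integrable D (EFin \o f i)) ->
  mu.-integrable D (EFin \o (fun x => \sum_(i <- s) f i x)).
Proof.
move=> mD hf; elim: s => [|i s IH].
  rewrite (_ : EFin \o _ = cst 0%E); first exact: integrable0.
  by apply/funext => x /=; rewrite big_nil.
rewrite (_ : EFin \o _ = (EFin \o f i) \+ (EFin \o (fun x => (\sum_(i <- s) f i x)%R)))%E.
  exact: integrableD.
by apply/funext => x /=; rewrite big_cons EFinD.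
Qed.

Lemma Rintegral_sum (D : set T) (I : Type) (s : seq I) (f : I -> T -> R) :
  measurable D -> (forall i, mu.-integrable D (EFin \o f i)) ->
  \int[mu]_(x in D) (\sum_(i <- s) f i x) = \sum_(i <- s) \int[mu]_(x in D) f i x.
Proof.
move=> mD hf; elim: s => [|i s IH].
  rewrite big_nil; under eq_Rintegral do rewrite big_nil.
  by rewrite Rintegral_cst // mul0r.
rewrite big_cons -IH -RintegralD //; last exact: integrable_EFin_sum.
by apply: eq_Rintegral => x _; rewrite big_cons.
Qed.

End RintegralSum.

Section BoundedHistory.
Context (R : realType) (dO : measure_display) (Omega : measurableType dO).
Context (dT : measure_display) (T : measurableType dT) (K : nat).
Variables (P : probability Omega R) (X : 'I_K -> Omega -> T).
Hypothesis mX : forall k, measurable_fun setT (X k).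
Implicit Types (S : {set 'I_K}) (Y Z : Omega -> R).

(** Boundedness is bundled with measurability so that the class is closed under products: entries of
    matrix polynomials in the sample are then integrable at once. *)
Definition bounded_hist S Y :=
  hist_measurable X S Y /\ exists C, forall w, `|Y w| <= C.

Lemma bounded_hist_cst S (c : R) : bounded_hist S (fun=> c).
Proof. by split; [exact: measurable_cst|exists `|c|]. Qed.

Lemma bounded_histD S Y Z : bounded_hist S Y -> bounded_hist S Z ->
  bounded_hist S (fun w => Y w + Z w).
Proof.
move=> [mY [C hC]] [mZ [C' hC']]; split; first exact: measurable_funD.
by exists (C + C') => w; rewrite (le_trans (ler_normD _ _)) // lerD.
Qed.

Lemma bounded_histM S Y Z : bounded_hist S Y -> bounded_hist S Z ->
  bounded_hist S (fun w => Y w * Z w).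
Proof.
move=> [mY [C hC]] [mZ [C' hC']]; split; first exact: measurable_funM.
by exists (C * C') => w; rewrite normrM ler_pM.
Qed.

Lemma bounded_hist_sum S (I : Type) (s : seq I) (p : pred I) (F : I -> Omega -> R) :
  (forall i, p i -> bounded_hist S (F i)) ->
  bounded_hist S (fun w => \sum_(i <- s | p i) F i w).
Proof.
move=> hF; elim: s => [|i s IH].
  rewrite (_ : (fun _ => _) = fun=> 0); first exact: bounded_hist_cst.
  by apply/funext => w; rewrite big_nil.
rewrite (_ : (fun _ => _) = fun w =>
    (if p i then F i w else 0) + \sum_(i <- s | p i) F i w).
  apply: bounded_histD => //; move: (hF i).
  by case: (p i) => [|_]; [exact|exact: bounded_hist_cst].
by apply/funext => w; rewrite big_cons; case: ifP => // _; rewrite add0r.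
Qed.

Lemma bounded_hist_measurable S Y : bounded_hist S Y -> measurable_fun setT Y.
Proof. by move=> [mY _]; exact (hist_measurable_fun mX mY). Qed.

Lemma bounded_hist_integrable S Y : bounded_hist S Y ->
  P.-integrable setT (EFin \o Y).
Proof.
move=> hY; apply: bounded_measurable_integrable; last by case: hY.
exact: bounded_hist_measurable hY.
Qed.

Context (n : nat).
Implicit Types F G : Omega -> 'M[R]_n.

Definition bounded_hist_mx S F := forall i j, bounded_hist S (fun w => F w i j).

Lemma bounded_hist_mx_cst S (A : 'M[R]_n) : bounded_hist_mx S (fun=> A).
Proof. by move=> i j; exact: bounded_hist_cst. Qed.

Lemma bounded_hist_mxD S F G : bounded_hist_mx S F -> bounded_hist_mx S G ->
  bounded_hist_mx S (fun w => F w + G w).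
Proof.
move=> hF hG i j; rewrite (_ : (fun _ => _) = fun w => F w i j + G w i j).
  exact: bounded_histD.
by apply/funext => w; rewrite mxE.
Qed.

Lemma bounded_hist_mxZ S a F : bounded_hist_mx S F ->
  bounded_hist_mx S (fun w => a *: F w).
Proof.
move=> hF i j; rewrite (_ : (fun _ => _) = fun w => a * F w i j).
  by apply: bounded_histM => //; exact: bounded_hist_cst.
by apply/funext => w; rewrite mxE.
Qed.

Lemma bounded_hist_mxM S F G : bounded_hist_mx S F -> bounded_hist_mx S G ->
  bounded_hist_mx S (fun w => F w * G w).
Proof.
move=> hF hG i j; rewrite (_ : (fun _ => _) = fun w => \sum_k F w i k * G w k j).
  by apply: bounded_hist_sum => k _; exact: bounded_histM.
by apply/funext => w; rewrite -mulmxE mxE.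
Qed.

Lemma bounded_hist_mxX S F m : bounded_hist_mx S F ->
  bounded_hist_mx S (fun w => F w ^+ m).
Proof.
move=> hF; elim: m => [|m IH]; first exact: bounded_hist_mx_cst.
rewrite (_ : (fun _ => _) = fun w => F w * F w ^+ m); first exact: bounded_hist_mxM.
by apply/funext => w; rewrite exprS.
Qed.

Lemma bounded_hist_mx_sum S (I : Type) (s : seq I) (p : pred I)
    (F : I -> Omega -> 'M[R]_n) : (forall i, p i -> bounded_hist_mx S (F i)) ->
  bounded_hist_mx S (fun w => \sum_(i <- s | p i) F i w).
Proof.
move=> hF i j; rewrite (_ : (fun _ => _) = fun w => \sum_(k <- s | p k) F k w i j).
  by apply: bounded_hist_sum => k pk; exact: hF.
by apply/funext => w; rewrite summxE.
Qed.

Lemma bounded_hist_mxtrace S F : bounded_hist_mx S F ->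
  bounded_hist S (fun w => \tr (F w)).
Proof. by move=> hF; apply: bounded_hist_sum => i _; exact: hF. Qed.

End BoundedHistory.

(** * Comparing [(1 - a / p) ^+ p] with the exponential *)

Section RealEstimates.
Context (R : realType).
Implicit Types x y a e : R.

Lemma Bernoulli_le y p : 0 <= y <= 1 -> 1 - p%:R * y <= (1 - y) ^+ p.
Proof.
move=> /andP[y0 y1]; elim: p => [|p IH]; first by rewrite mul0r subr0 expr0.
apply: (@le_trans _ _ ((1 - p%:R * y) * (1 - y))).
  have -> : (1 - p%:R * y) * (1 - y) = 1 - p.+1%:R * y + p%:R * (y * y).
    by rewrite -natr1; ring.
  by rewrite lerDl !mulr_ge0.
by rewrite exprSr ler_wpM2r // subr_ge0.
Qed.

(** With [x = a / p], the bound [1 + x <= expR x] gives [1 - x ^+ 2 <= (1 - x) * expR x]; the [p]-th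
    power of the left side is bounded below by Bernoulli. *)
Lemma expRN_le_expr a p : 0 <= a -> a <= p%:R -> (0 < p)%N ->
  (1 - a ^+ 2 / p%:R) * expR (- a) <= (1 - a / p%:R) ^+ p.
Proof.
move=> a0 ap p0; have pr : (0 : R) < p%:R by rewrite ltr0n.
set x := a / p%:R.
have x0 : 0 <= x by rewrite divr_ge0 // ltW.
have x1 : x <= 1 by rewrite ler_pdivrMr // mul1r.
have -> : a = p%:R * x by rewrite /x mulrC divfK // gt_eqF.
move: x x0 x1 => x x0 x1.
have E1 : expR (p%:R * x) * expR (- (p%:R * x)) = 1.
  by rewrite -expRD subrr expR0.
rewrite -[leRHS]mulr1 -[X in _ <= _ * X]E1 mulrA expRM_natl -exprMn.
apply: ler_wpM2r; first exact: expR_ge0.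
have -> : (p%:R * x) ^+ 2 / p%:R = p%:R * x ^+ 2 by field; rewrite gt_eqF.
apply: le_trans (Bernoulli_le _ _) _; first by rewrite sqr_ge0 expr_le1.
apply: lerXn2r; rewrite ?nnegrE ?mulr_ge0 ?expR_ge0 ?subr_ge0 ?expr_le1 //.
have -> : 1 - x ^+ 2 = (1 - x) * (1 + x) by ring.
by rewrite ler_wpM2l ?subr_ge0 // expR_ge1Dx.
Qed.

End RealEstimates.

(** * Lower-tail matrix Chernoff bound *)

Section MatrixChernoff.
Context (R : realType) (dO : measure_display) (Omega : measurableType dO).
Context (dT : measure_display) (T : measurableType dT) (K n : nat).
Variables (P : probability Omega R) (mu : probability T R).
Variables (X : 'I_K -> Omega -> T) (Q : T -> 'M[R]_n) (M : R).
Hypothesis hX : iid_sample P mu X.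
Hypothesis mQ : forall i j, measurable_fun setT (fun x => Q x i j).
Hypothesis sQ : forall x, symmx (Q x).
Hypothesis pQ : forall x, psd (Q x).
Hypothesis pQ2 : forall x, psd (M *: Q x - Q x ^+ 2).
Hypothesis bQ : forall x i j, `|Q x i j| <= M.
Hypothesis EQ : forall i j, \int[mu]_x Q x i j = (i == j)%:R.
Hypothesis M1 : 1 <= M.

Let mX k : measurable_fun setT (X k).
Proof. by have [] := hX. Qed.

Let M0 : 0 <= M. Proof. exact: le_trans ler01 M1. Qed.

Definition first_sum m w : 'M[R]_n := \sum_(k < K | (k < m)%N) Q (X k w).

Definition first_indices m : {set 'I_K} := [set k : 'I_K | (k < m)%N].

Lemma first_sumS (k : 'I_K) w : first_sum k.+1 w = first_sum k w + Q (X k w).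
Proof.
rewrite /first_sum (bigD1 k) //= addrC; congr (_ + _); apply: eq_bigl => i.
by rewrite ltnS ltn_neqAle andbC.
Qed.

Lemma symmx_first_sum m w : symmx (first_sum m w).
Proof. by apply: symmx_sum => k _; exact: sQ. Qed.

Lemma mxl1_Q x : mxl1 (Q x) <= n%:R ^+ 2 * M.
Proof.
apply: (@le_trans _ _ (\sum_(i < n) \sum_(j < n) M)).
  by apply: ler_sum => i _; apply: ler_sum => j _; exact: bQ.
by rewrite !sumr_const !card_ord -[leLHS]mulr_natl -[M *+ n]mulr_natl expr2 mulrA.
Qed.

Lemma mxl1_first_sum m w : mxl1 (first_sum m w) <= K%:R * (n%:R ^+ 2 * M).
Proof.
have B0 : 0 <= n%:R ^+ 2 * M by rewrite mulr_ge0 ?sqr_ge0.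
apply: (@le_trans _ _ (\sum_(k < K | (k < m)%N) n%:R ^+ 2 * M)).
  rewrite /first_sum; elim/big_ind2: _ => [|A a B b hA hB|k _].
  - by rewrite -(scale0r (0 : 'M[R]_n)) mxl1Z normr0 mul0r.
  - by rewrite (le_trans (mxl1D _ _)) // lerD.
  - exact: mxl1_Q.
rewrite sumr_const -[leLHS]mulr_natl ler_wpM2r // ler_nat.
by rewrite -[leqRHS]card_ord; exact: max_card.
Qed.

Lemma bounded_hist_Q (S : {set 'I_K}) k : k \in S ->
  bounded_hist_mx X S (fun w => Q (X k w)).
Proof.
move=> kS i j; split; last by exists M => w; exact: bQ.
exact: (hist_measurable_comp (Z := fun x => Q x i j) kS (mQ i j)).
Qed.

Lemma bounded_hist_first_sum m : bounded_hist_mx X (first_indices m) (first_sum m).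
Proof.
by apply: bounded_hist_mx_sum => k km; apply: bounded_hist_Q; rewrite inE.
Qed.

Lemma Rintegral_Q k i j : \int[P]_w Q (X k w) i j = (i == j)%:R.
Proof.
rewrite -EQ /Rintegral; congr fine.
have iQ : mu.-integrable setT (fun x => (Q x i j)%:E).
  by apply: bounded_measurable_integrable; last by exists M => x; exact: bQ.
have pushE : (\int[mu]_x (Q x i j)%:E =
    \int[pushforward P (X k)]_x (Q x i j)%:E)%E.
  by apply: eq_measure_integral => A mA _; have [_ h _] := hX; exact/esym/h.
rewrite pushE integral_pushforward //; first exact/measurable_EFinP.
exact: (bounded_hist_integrable P mX (bounded_hist_Q (set11 k) i j)).
Qed.

(** [Q (X k w)] is independent of the entries of [F] and has mean [1], so a fresh sample contributes
    the scalar factor [1 - c]. *)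
Lemma Rintegral_mxtraceM_Q (k : 'I_K) (S : {set 'I_K}) (F : Omega -> 'M[R]_n) (c : R) :
  k \notin S -> bounded_hist_mx X S F ->
  P.-integrable setT (EFin \o (fun w => \tr (F w * (1 - c *: Q (X k w))))) /\
  (\int[P]_w (\tr (F w * (1 - c *: Q (X k w))))) = (1 - c) * (\int[P]_w (\tr (F w))).
Proof.
move=> kS hF.
have iF i j : P.-integrable setT (EFin \o (fun w => F w i j)).
  exact: (bounded_hist_integrable P mX (hF i j)).
have hQ i j := bounded_hist_Q (set11 k) i j.
have iFQ i j : P.-integrable setT (EFin \o (fun w => F w i j * Q (X k w) j i)).
  apply: bounded_measurable_integrable.
    apply: measurable_funM; first exact: (bounded_hist_measurable mX (hF i j)).
    exact: (bounded_hist_measurable mX (hQ j i)).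
  have [_ [C hC]] := hF i j; exists (C * M) => w.
  by rewrite normrM ler_pM.
have EFQ i j : (\int[P]_w (F w i j * Q (X k w) j i)) = (\int[P]_w F w i j) * (j == i)%:R.
  rewrite -(Rintegral_Q k);
    apply: (@Rintegral_histM _ _ _ _ _ _ P _ mX _ S k (fun w => F w i j) (fun x => Q x j i)) => //.
  - by have [] := hX.
  - by have [] := hF i j.
  - exact: (bounded_hist_integrable P mX (hQ j i)).
  - exact: iFQ.
have trE : (fun w => \tr (F w * (1 - c *: Q (X k w)))) =
    (fun w => \sum_i (F w i i - c * \sum_j (F w i j * Q (X k w) j i))).
  apply/funext => w; apply: eq_bigr => i _.
  by rewrite mulrBr mulr1 -mulmxE -scalemxAr !mxE.
have iS i : P.-integrable setT (EFin \o (fun w => \sum_j (F w i j * Q (X k w) j i))).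
  by apply: integrable_EFin_sum.
have iD i : P.-integrable setT
    (EFin \o (fun w => c * \sum_j (F w i j * Q (X k w) j i))).
  exact: (integrableZl measurableT c (iS i)).
have iB i : P.-integrable setT
    (EFin \o (fun w => F w i i - c * \sum_j (F w i j * Q (X k w) j i))).
  exact: (integrableB measurableT (iF i i) (iD i)).
split; first by rewrite trE; exact: integrable_EFin_sum.
rewrite trE Rintegral_sum //.
rewrite [in RHS]/mxtrace Rintegral_sum // mulr_sumr; apply: eq_bigr => i _.
rewrite RintegralB // RintegralZl // Rintegral_sum //.
rewrite (bigD1 i) //= EFQ eqxx mulr1 big1 ?addr0.
  by rewrite mulrBl mul1r.
by move=> j ji; rewrite EFQ (negbTE ji) mulr0.
Qed.

Lemma bounded_hist_expr m (eta : R) p :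
  bounded_hist_mx X (first_indices m) (fun w => (1 - eta *: first_sum m w) ^+ p).
Proof.
apply: bounded_hist_mxX; apply: bounded_hist_mxD; first exact: bounded_hist_mx_cst.
have := bounded_hist_mxZ (- eta) (bounded_hist_first_sum m).
by under eq_fun do rewrite scaleNr.
Qed.

(** Induction on the number of samples: [mxtrace_step] splits off the newest one, averaging over it
    gives [1 - c], and one Trotter error is added. Earlier errors do not grow because [1 - c] lies
    in the unit interval, and a single error term serves all steps because [K * n ^ 2 * M] bounds
    the norm of every partial sum. *)
Lemma Rintegral_mxtrace_expr_le (eta th : R) l p m :
  p = (2 ^ l.+1)%N -> th = p%:R * eta -> 0 <= eta -> eta * M <= 1 ->
  eta * (K%:R * (n%:R ^+ 2 * M)) <= 1 -> 0 <= th - th ^+ 2 * M / 2 <= 1 -> (m <= K)%N ->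
  (\int[P]_w (\tr ((1 - eta *: first_sum m w) ^+ p))) <=
  (1 - (th - th ^+ 2 * M / 2)) ^+ m * n%:R +
  m%:R * (p%:R * n%:R * (1 + 3 * (eta * (K%:R * (n%:R ^+ 2 * M)))) ^+ p *
    (eta * (K%:R * (n%:R ^+ 2 * M))) ^+ 2).
Proof.
move=> pE thE eta0 etaM; set a := K%:R * _ => etaa; set c := th - _ => /andP[c0 c1].
set err := _ * (eta * a) ^+ 2.
elim: m => [_|m IH mK].
  rewrite expr0 mul1r mul0r addr0.
  under eq_Rintegral do rewrite /first_sum big_pred0 // scaler0 subr0 expr1n mxtrace1.
  by rewrite Rintegral_cst_probability.
pose k := Ordinal mK; set F := fun w => (1 - eta *: first_sum m w) ^+ p.
have kS : k \notin first_indices m by rewrite inE ltnn.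
have hF : bounded_hist_mx X (first_indices m) F by exact: bounded_hist_expr.
have iF := bounded_hist_integrable P mX (bounded_hist_mxtrace hF).
have iS := bounded_hist_integrable P mX (bounded_hist_mxtrace (bounded_hist_expr m.+1 eta p)).
have [iFQ EFQ] := Rintegral_mxtraceM_Q c kS hF.
have icst : P.-integrable setT (EFin \o (fun=> err)).
  by apply: bounded_measurable_integrable => //; exists `|err|.
apply: (@le_trans _ _ (\int[P]_w (\tr (F w * (1 - c *: Q (X k w))) + err))).
  apply: le_Rintegral => //.
    exact: (integrableD measurableT iFQ icst).
  move=> w _; rewrite (first_sumS k).
  apply: (mxtrace_step _ _ _ _ _ _ _ _ _ _ pE thE) => //.
  - exact: symmx_first_sum.
  - exact: mxl1_first_sum.
  apply: (le_trans (mxl1_Q _)); rewrite ler_peMl ?mulr_ge0 ?sqr_ge0 //.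
  by rewrite ler1n (leq_ltn_trans _ mK).
rewrite RintegralD // Rintegral_cst_probability.
rewrite EFQ.
have := IH (ltnW mK); rewrite -/F => /(ler_wpM2l (_ : 0 <= 1 - c)).
rewrite subr_ge0 => /(_ c1) h; apply: le_trans (lerD h (lexx err)) _.
have err0 : 0 <= err.
  rewrite /err !mulr_ge0 ?sqr_ge0 ?ler0n // exprn_ge0 // addr_ge0 // !mulr_ge0 ?sqr_ge0 //.
have : (1 - c) * (m%:R * err) <= m%:R * err.
  by apply: ler_piMl; [exact: mulr_ge0|rewrite lerBlDr lerDl].
rewrite exprS -natr1; move: ((1 - c) ^+ m) => A.
lra.
Qed.

End MatrixChernoff.

Section MatrixChernoffBound.
Context (R : realType) (dO : measure_display) (Omega : measurableType dO).
Context (dT : measure_display) (T : measurableType dT) (K n : nat).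
Variables (P : probability Omega R) (mu : probability T R).
Variables (X : 'I_K -> Omega -> T) (Q : T -> 'M[R]_n) (M : R).

(* [Phi] dominates the indicator of a failure of the quadratic-form lower bound; it is
   \tr ((1 - eta S) ^+ p) / (1 - eta K / 2) ^+ p with S = \sum_k Q (X k w), eta = 1 / (2 p M)
   and p a large power of 2. *)
Lemma matrix_Chernoff_lower : iid_sample P mu X ->
  (forall i j, measurable_fun setT (fun x => Q x i j)) ->
  (forall x, symmx (Q x)) -> (forall x, psd (Q x)) ->
  (forall x, psd (M *: Q x - Q x ^+ 2)) ->
  (forall x i j, `|Q x i j| <= M) ->
  (forall i j, \int[mu]_x Q x i j = (i == j)%:R) -> 1 <= M -> (0 < K)%N ->
  exists Phi : Omega -> R, [/\ P.-integrable setT (EFin \o Phi),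
    forall w, 0 <= Phi w,
    forall w v, qform (\sum_k Q (X k w)) v < K%:R / 2 * qform 1 v -> 1 <= Phi w &
    \int[P]_w Phi w <= 2 * n%:R * expR (- (K%:R / (8 * M)))].
Proof.
move=> hX mQ sQ pQ pQ2 bQ EQ M1 K0.
have M0 : 0 < M by exact: lt_le_trans ltr01 M1.
have Mn0 : M != 0 by rewrite gt_eqF.
have mX k : measurable_fun setT (X k) by case: hX.
have KR : (0 : R) < K%:R by rewrite ltr0n.
(* The averaged trace decays like [expR (- (c * K))] with [c = 3 / (8 * M)], and the normalization
   costs [expR a'], where [a' = th * K / 2]. The difference [c * K - a'] is [K / (8 * M)], its
   maximum over [th]. *)
pose a := K%:R * (n%:R ^+ 2 * M); pose th := (2 * M)^-1.
pose c := th - th ^+ 2 * M / 2; pose a' := K%:R / (4 * M).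
have cE : c = 3 / (8 * M) by rewrite /c /th; field.
have a0 : 0 <= a by rewrite !mulr_ge0 ?sqr_ge0 // ltW.
have th0 : 0 < th by rewrite invr_gt0 mulr_gt0.
have a'0 : 0 < a' by rewrite divr_gt0 // mulr_gt0.
have c01 : 0 <= c <= 1.
  rewrite cE divr_ge0 ?mulr_ge0 ?(ltW M0) //=.
  by rewrite ler_pdivrMr ?mulr_gt0 // mul1r; move: M1 => /=; lra.
pose C0 := (th * a) ^+ 2 * expR (3 * (th * a)).
have C00 : 0 <= C0 by rewrite mulr_ge0 ?sqr_ge0 // expR_ge0.
(* Each summand is one demand on [p]: that [eta * a <= 1], that normalization loses at most the
   factor [3 / 4], that the normalizing base is positive, and that the Trotter errors stay below
   half of the main term. *)
pose B := th * a + 4 * a' ^+ 2 + a' + 2 * K%:R * C0 * expR (c * K%:R).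
have t1 : 0 <= th * a by rewrite mulr_ge0 // ltW.
have t2 : 0 <= 4 * a' ^+ 2 by rewrite mulr_ge0 ?sqr_ge0.
have t3 : 0 <= 2 * K%:R * C0 * expR (c * K%:R).
  by rewrite !mulr_ge0 ?expR_ge0 // ltW.
have [l [p [pE Bp]]] : exists l p, p = (2 ^ l.+1)%N /\ B < p%:R.
  have B0 : 0 <= B by rewrite /B; move: a'0; lra.
  exists (Num.bound B), (2 ^ (Num.bound B).+1)%N; split => //.
  apply: (lt_le_trans (archi_boundP B0)); rewrite ler_nat.
  by rewrite (leq_trans (ltnW (ltn_expl _ (ltnSn 1)))) // leq_pexp2l.
have p0 : (0 : R) < p%:R by rewrite ltr0n pE expn_gt0.
have pn0 : (p%:R : R) != 0 by rewrite gt_eqF.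
have p1 : (1 : R) <= p%:R by rewrite ler1n pE expn_gt0.
have [pa pa2 pa' pC] : [/\ th * a <= p%:R, 4 * a' ^+ 2 <= p%:R, a' < p%:R &
    2 * K%:R * C0 * expR (c * K%:R) <= p%:R].
  by move: Bp; rewrite /B; split; lra.
pose eta := th / p%:R.
have eta0 : 0 < eta by rewrite divr_gt0.
have thE : th = p%:R * eta by rewrite /eta mulrC divfK.
have etaM : eta * M <= 1.
  rewrite /eta /th mulrAC invfM mulfVK // ler_pdivrMr // mul1r.
  by apply: le_trans p1; lra.
have etaa : eta * a <= 1.
  by rewrite /eta mulrAC ler_pdivrMr // mul1r.
have betaE : 1 - eta * (K%:R / 2) = 1 - a' / p%:R.
  by rewrite /eta /th /a'; field; rewrite Mn0 pn0.
have beta0 : 0 < 1 - a' / p%:R by rewrite subr_gt0 ltr_pdivrMr // mul1r.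
have betap0 : 0 < (1 - a' / p%:R) ^+ p by rewrite exprn_gt0.
pose S := first_sum X Q K.
have SE w : S w = \sum_k Q (X k w) by apply: eq_bigl => k; rewrite ltn_ord.
have sS w : symmx (1 - eta *: S w).
  by apply: symmx1B; apply: symmxZ; exact: symmx_first_sum.
have trS0 w : 0 <= \tr ((1 - eta *: S w) ^+ p).
  rewrite pE expnSr exprM expr2 -{2}(symmxX (2 ^ l) (sS w)).
  exact: mxtrace_gram_ge0.
have iS : P.-integrable setT (EFin \o (fun w => \tr ((1 - eta *: S w) ^+ p))).
  by have := bounded_hist_integrable P mX
    (bounded_hist_mxtrace (bounded_hist_expr X mQ bQ K eta p)); apply.
exists (fun w => ((1 - a' / p%:R) ^+ p)^-1 * \tr ((1 - eta *: S w) ^+ p)); split.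
- exact: (integrableZl measurableT _ iS).
- by move=> w; rewrite mulr_ge0 // invr_ge0 ltW.
- move=> w v; rewrite -SE => hv; rewrite mulrC ler_pdivlMr // mul1r.
  have v0 : v != 0.
    apply/eqP => v0; move: hv; rewrite v0 /qform !mulmx0 !mxE mulr0 ltxx //.
  have := mxtrace_expr_pow2_ge l (sS w) (ltW beta0) v0; rewrite -pE; apply.
  rewrite -betaE qformD qformN qformZ mulrBl mul1r lerD2l lerN2 -[leRHS]mulrA.
  by apply: ler_wpM2l; apply: ltW.
rewrite RintegralZl // mulrC ler_pdivrMr //.
have := @Rintegral_mxtrace_expr_le _ _ _ _ _ _ _ P mu X Q M hX mQ sQ pQ pQ2 bQ EQ M1
  eta th l p K pE thE (ltW eta0) etaM etaa c01 (leqnn K).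
rewrite -/S -/c -/a => /le_trans; apply.
have ck : (1 - c) ^+ K <= expR (- (c * K%:R)).
  rewrite -mulNr mulrC expRM_natl; apply: lerXn2r; rewrite ?nnegrE ?expR_ge0 //.
    by rewrite subr_ge0; case/andP: c01.
  exact: expR_ge1Dx.
have errE : p%:R * n%:R * (1 + 3 * (eta * a)) ^+ p * (eta * a) ^+ 2 <= n%:R * C0 / p%:R.
  have -> : n%:R * C0 / p%:R = p%:R * n%:R * expR (3 * (th * a)) * (eta * a) ^+ 2.
    by rewrite /C0 /eta; field.
  apply: ler_wpM2r; first exact: sqr_ge0.
  apply: ler_wpM2l; first by rewrite mulr_ge0.
  have -> : 3 * (th * a) = p%:R * (3 * (eta * a)) by rewrite thE; ring.
  rewrite expRM_natl; apply: lerXn2r; rewrite ?nnegrE ?expR_ge0 ?expR_ge1Dx //.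
  by rewrite addr_ge0 // !mulr_ge0 // ltW.
have betaP : 3 / 4 * expR (- a') <= (1 - a' / p%:R) ^+ p.
  apply: le_trans (expRN_le_expr (ltW a'0) (ltW pa') _); last by rewrite -(ltr0n R).
  apply: ler_wpM2r; first exact: expR_ge0.
  have : a' ^+ 2 / p%:R <= 4^-1 by rewrite ler_pdivrMr // mulrC ler_pdivlMr // mulrC.
  by move: (_ / _) => x; lra.
have expE : expR (- (K%:R / (8 * M))) * expR (- a') = expR (- (c * K%:R)).
  by rewrite -expRD cE /a'; congr expR; field.
(* The main term and the Trotter errors add up to [3 / 2] of the main term; division by the [3 / 4]
   of [betaP] gives the factor [2] of the conclusion. *)
have small : K%:R * (C0 / p%:R) <= expR (- (c * K%:R)) / 2.
  rewrite expRN mulrA ler_pdivrMr // -(ler_pM2r (expR_gt0 (c * K%:R))).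
  have -> : (expR (c * K%:R))^-1 / 2 * p%:R * expR (c * K%:R) = p%:R / 2.
    by field; rewrite gt_eqF // expR_gt0.
  by rewrite ler_pdivlMr // mulrC; apply: le_trans pC; rewrite !mulrA lexx.
apply: (@le_trans _ _ (n%:R * (3 / 2 * expR (- (c * K%:R))))).
  apply: (@le_trans _ _ (expR (- (c * K%:R)) * n%:R + K%:R * (n%:R * C0 / p%:R))).
    by apply: lerD; [exact: ler_wpM2r|apply: ler_wpM2l => //; exact: ltW].
  have -> : K%:R * (n%:R * C0 / p%:R) = n%:R * (K%:R * (C0 / p%:R)) by ring.
  rewrite [_ * n%:R]mulrC -mulrDr; apply: ler_wpM2l => //; move: small; lra.
rewrite -expE.
have -> : n%:R * (3 / 2 * (expR (- (K%:R / (8 * M))) * expR (- a'))) =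
    2 * n%:R * expR (- (K%:R / (8 * M))) * (3 / 4 * expR (- a')) by field.
by apply: ler_wpM2l; rewrite // !mulr_ge0 ?expR_ge0.
Qed.

End MatrixChernoffBound.

(** * Euclidean geometry and the truncation map *)

Section EuclideanDot.
Context (R : realType) (n : nat).
Implicit Types u v w : 'cV[R]_n.

Lemma dotvC u v : dotv u v = dotv v u.
Proof. by apply: eq_bigr => i _; rewrite mulrC. Qed.

Lemma dotvDl u v w : dotv (u + v) w = dotv u w + dotv v w.
Proof. by rewrite -big_split; apply: eq_bigr => i _; rewrite mxE mulrDl. Qed.

Lemma dotvZl a u v : dotv (a *: u) v = a * dotv u v.
Proof. by rewrite mulr_sumr; apply: eq_bigr => i _; rewrite mxE mulrA. Qed.

Lemma dotvNl u v : dotv (- u) v = - dotv u v.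
Proof. by rewrite -scaleN1r dotvZl mulN1r. Qed.

Lemma dotvDr u v w : dotv u (v + w) = dotv u v + dotv u w.
Proof. by rewrite dotvC dotvDl !(dotvC u). Qed.

Lemma dotvZr a u v : dotv u (a *: v) = a * dotv u v.
Proof. by rewrite dotvC dotvZl dotvC. Qed.

Lemma dotvNr u v : dotv u (- v) = - dotv u v.
Proof. by rewrite dotvC dotvNl dotvC. Qed.

Lemma dot0v v : dotv 0 v = 0.
Proof. by apply: big1 => i _; rewrite mxE mul0r. Qed.

Lemma dotv_suml (I : Type) (s : seq I) (F : I -> 'cV[R]_n) v :
  dotv (\sum_(i <- s) F i) v = \sum_(i <- s) dotv (F i) v.
Proof.
by elim/big_rec2: _ => [|i y1 y2 _ <-]; [exact: dot0v|exact: dotvDl].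
Qed.

Lemma dotv_sumr (I : Type) (s : seq I) (F : I -> 'cV[R]_n) v :
  dotv v (\sum_(i <- s) F i) = \sum_(i <- s) dotv v (F i).
Proof. by rewrite dotvC dotv_suml; apply: eq_bigr => i _; exact: dotvC. Qed.

Lemma dotv_ge0 v : 0 <= dotv v v.
Proof. by apply: sumr_ge0 => i _; rewrite -expr2 sqr_ge0. Qed.

Lemma norm2_sqr v : norm2 v ^+ 2 = dotv v v.
Proof. by rewrite sqr_sqrtr // dotv_ge0. Qed.

Lemma norm2_ge0 v : 0 <= norm2 v.
Proof. exact: sqrtr_ge0. Qed.

Lemma dotv_sqr_le u v : dotv u v ^+ 2 <= dotv u u * dotv v v.
Proof.
have E w : dotv w w = \sum_i w i 0 ^+ 2 by apply: eq_bigr => i _; rewrite expr2.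
by rewrite !E; exact: sum_Cauchy_Schwarz.
Qed.

Lemma dotv_le_norm2 u v : dotv u v <= norm2 u * norm2 v.
Proof.
apply: le_trans (ler_norm _) _.
rewrite -(@ler_pXn2r _ 2) ?nnegrE ?mulr_ge0 ?norm2_ge0 //.
by rewrite real_normK ?num_real // exprMn !norm2_sqr dotv_sqr_le.
Qed.

Lemma dotv_le_half u v : `|dotv u v| <= (dotv u u + dotv v v) / 2.
Proof.
have h1 := dotv_ge0 (u + v); have h2 := dotv_ge0 (u - v).
move: h1 h2; rewrite !(dotvDl, dotvDr, dotvNl, dotvNr) (dotvC v u).
by move: (dotv u v) (dotv u u) (dotv v v) => x y z h1 h2; rewrite ler_norml; lra.
Qed.

Lemma dotvB_le u v : dotv (u - v) (u - v) <= 2 * dotv u u + 2 * dotv v v.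
Proof.
have h1 := dotv_ge0 (u + v).
move: h1; rewrite !(dotvDl, dotvDr, dotvNl, dotvNr) (dotvC v u).
by move: (dotv u v) (dotv u u) (dotv v v) => x y z; lra.
Qed.

Lemma truncT_id (L : R) v : norm2 v <= L -> truncT L v = v.
Proof.
move=> vL; rewrite /truncT max_r //.
(* For [L = 0] the scaling factor is [0 / 0], which evaluates to [0]; this is correct because the
   vector itself then vanishes. *)
have [L0|L0] := eqVneq L 0; last by rewrite divff // scale1r.
suff -> : v = 0 by rewrite scaler0.
have : dotv v v = 0.
  rewrite -norm2_sqr; apply/eqP; rewrite sqrf_eq0 eq_le norm2_ge0 andbT.
  by rewrite (le_trans vL) // L0.
move=> /eqP; rewrite psumr_eq0; last by move=> i _; rewrite -expr2 sqr_ge0.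
move=> /allP h; apply/matrixP => i j; rewrite (ord1 j) mxE.
by have := h i (mem_index_enum _); rewrite mulf_eq0 orbb => /eqP.
Qed.

Lemma norm2Z a v : 0 <= a -> norm2 (a *: v) = a * norm2 v.
Proof.
move=> a0; rewrite /norm2 dotvZl dotvZr mulrA -expr2 sqrtrM ?sqr_ge0 //.
by rewrite sqrtr_sqr ger0_norm.
Qed.

Lemma norm2_truncT (L : R) v : 0 <= L -> norm2 (truncT L v) <= L.
Proof.
move=> L0; have [vL|vL] := leP (norm2 v) L; first by rewrite truncT_id.
have v0 : 0 < norm2 v by exact: le_lt_trans vL.
rewrite /truncT max_l ?(ltW vL) // norm2Z ?divr_ge0 // ?(ltW v0) //.
by rewrite divfK // gt_eqF.
Qed.

(** Truncation is radial projection onto a ball that contains [u]. If [v] lies outside and is scaled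
    by [t], the squared distance drops by [1 - t] times [2 * (t * dotv v v - dotv u v) + (1 - t) *
    dotv v v], and [dotv u v <= L * norm2 v = t * dotv v v]. *)
Lemma truncT_dist_le (L : R) u v : 0 <= L -> norm2 u <= L ->
  dotv (u - truncT L v) (u - truncT L v) <= dotv (u - v) (u - v).
Proof.
move=> L0 uL; have [vL|vL] := leP (norm2 v) L; first by rewrite truncT_id.
have v0 : 0 < norm2 v by exact: le_lt_trans vL.
rewrite /truncT max_l ?(ltW vL) //; set t := L / norm2 v.
have t0 : 0 <= t by rewrite divr_ge0 // ltW.
have t1 : t < 1 by rewrite ltr_pdivrMr // mul1r.
have tv : t * dotv v v = L * norm2 v.
  by rewrite -norm2_sqr /t expr2 mulrA divfK // gt_eqF.
have uv : dotv u v <= t * dotv v v.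
  rewrite tv; apply: le_trans (dotv_le_norm2 _ _) _.
  by rewrite ler_wpM2r // norm2_ge0.
have := dotv_ge0 v.
rewrite !(dotvDl, dotvDr, dotvNl, dotvNr, dotvZl, dotvZr) (dotvC v u).
move: uv; move: (dotv u v) (dotv u u) (dotv v v) => x y z xz z0.
have h1 : 0 <= (1 - t) * (2 * (t * z - x)) by apply: mulr_ge0; lra.
have h2 : 0 <= (1 - t) * ((1 - t) * z) by rewrite !mulr_ge0 //; lra.
rewrite -subr_ge0; apply: le_trans (addr_ge0 h1 h2) _.
by rewrite le_eqVlt; apply/orP; left; apply/eqP; ring.
Qed.

Lemma truncT_dist_bound (L : R) u v : 0 <= L -> norm2 u <= L ->
  dotv (u - truncT L v) (u - truncT L v) <= 4 * L ^+ 2.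
Proof.
move=> L0 uL; apply: le_trans (dotvB_le _ _) _.
rewrite -!norm2_sqr.
have h1 : norm2 u ^+ 2 <= L ^+ 2 by rewrite lerXn2r ?nnegrE ?norm2_ge0.
have h2 : norm2 (truncT L v) ^+ 2 <= L ^+ 2.
  by rewrite lerXn2r ?nnegrE ?norm2_ge0 ?norm2_truncT.
by move: h1 h2; move: (_ ^+ 2) (_ ^+ 2) (_ ^+ 2) => a b c; lra.
Qed.

End EuclideanDot.

(** First variation without derivatives: a nonzero [A] is refuted at [t = A / B], or at [t = A] when
    [B] is not positive. It turns minimality into orthogonality. *)
Lemma nonneg_quadratic_linear0 (R : realFieldType) (A B : R) :
  (forall t, 0 <= - (2 * t * A) + t ^+ 2 * B) -> A = 0.
Proof.
move=> h; apply/eqP; apply/negPn/negP => A0.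
have [B0|B0] := leP B 0.
  have := h A; have : 0 < A ^+ 2 by rewrite exprn_even_gt0.
  have : A ^+ 2 * B <= 0 by rewrite mulr_ge0_le0 ?sqr_ge0.
  by rewrite -mulrA -expr2; move: (A ^+ 2) => x; lra.
have := h (A / B); have : 0 < A ^+ 2 / B by rewrite divr_gt0 // exprn_even_gt0.
have -> : - (2 * (A / B) * A) + (A / B) ^+ 2 * B = - (A ^+ 2 / B).
  by field; rewrite gt_eqF.
lra.
Qed.

(** * Measurability of vector fields *)

Section FieldMeasurability.
Context (R : realType) (d : measure_display) (T : measurableType d) (n : nat).
Implicit Types (D : set T) (f g : T -> 'cV[R]_n).

(** The componentwise form gives access to the closure properties of real-valued functions;
    [measurable_fun_borelcV] derives it from Borel measurability. *)
Definition measurable_field D f := forall i, measurable_fun D (fun x => f x i 0).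

Lemma measurable_field_dotv D f g : measurable_field D f -> measurable_field D g ->
  measurable_fun D (fun x => dotv (f x) (g x)).
Proof. by move=> mf mg; apply: measurable_sum => i; exact: measurable_funM. Qed.

Lemma measurable_fieldD D f g : measurable_field D f -> measurable_field D g ->
  measurable_field D (fun x => f x + g x).
Proof.
move=> mf mg i; under eq_fun do rewrite mxE; exact: measurable_funD.
Qed.

Lemma measurable_fieldM D (a : T -> R) f : measurable_fun D a ->
  measurable_field D f -> measurable_field D (fun x => a x *: f x).
Proof.
move=> ma mf i; under eq_fun do rewrite mxE; exact: measurable_funM.
Qed.

Lemma measurable_fieldB D f g : measurable_field D f -> measurable_field D g ->
  measurable_field D (fun x => f x - g x).
Proof.
move=> mf mg; apply: measurable_fieldD => // i.
by under eq_fun do rewrite mxE; exact: measurable_funN.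
Qed.

Lemma measurable_field_truncT D (L : R) f : 0 <= L -> measurable_field D f ->
  measurable_field D (fun x => truncT L (f x)).
Proof.
move=> L0 mf; apply: measurable_fieldM => //.
have mN : measurable_fun D (fun x => norm2 (f x)).
  under eq_fun do rewrite /norm2 -powR12_sqrt ?dotv_ge0 //.
  apply: (measurableT_comp (measurable_powR _)).
  exact: measurable_field_dotv.
have mM : measurable_fun D (fun x => Num.max (norm2 (f x)) L).
  exact: measurable_maxr.
under eq_fun do rewrite -powR_inv1 ?le_max ?L0 ?orbT //.
apply: measurable_funM => //.
exact: (measurableT_comp (measurable_powR _)).
Qed.

End FieldMeasurability.

Lemma measurable_fun_borelcV (R : realType) n d (T : measurableType d)
    (D : set T) (f : T -> borelcV R n) :
  measurable_fun D f -> measurable_field D (f : T -> 'cV[R]_n).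
Proof.
move=> mf i.
have mi : measurable_fun setT (fun v : borelcV R n => (v : 'cV[R]_n) i 0).
  apply: (measurability (RGenOInfty.G (R := R))).
    exact: RGenOInfty.measurableE.
  move=> _ [_ [x ->] <-]; rewrite setTI; apply: sub_sigma_algebra.
  apply: open_comp; last exact: rray_open.
  by move=> v _; exact: coord_continuous.
exact: (measurableT_comp mi mf).
Qed.

Lemma open_measurable_borelcV (R : realType) n (D : set 'cV[R]_n) :
  open D -> measurable (D : set (borelcV R n)).
Proof. by move=> oD; exact: sub_sigma_algebra. Qed.

(** * Moments of functions of an i.i.d. sample *)

Section IidMoments.
Context (R : realType) (dO : measure_display) (Omega : measurableType dO).
Context (dT : measure_display) (T : measurableType dT) (K : nat).
Variables (P : probability Omega R) (mu : probability T R) (X : 'I_K -> Omega -> T).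
Hypothesis hX : iid_sample P mu X.

Lemma sample_integral k (f : T -> \bar R) :
  (\int[mu]_x f x = \int[pushforward P (X k)]_x f x)%E.
Proof.
have [mX law _] := hX.
by apply: eq_measure_integral => // A mA _; exact/esym/law.
Qed.

Lemma sample_integrable k (phi : T -> R) : mu.-integrable setT (EFin \o phi) ->
  P.-integrable setT (EFin \o (phi \o X k)).
Proof.
have [mX _ _] := hX; move=> /integrableP[/measurable_EFinP mphi iphi].
apply/integrableP; split; first exact/measurable_EFinP/measurableT_comp.
rewrite (sample_integral k) ge0_integral_pushforward // in iphi.
by apply: measurableT_comp => //; exact/measurable_EFinP.
Qed.

Lemma sample_Rintegral k (phi : T -> R) : mu.-integrable setT (EFin \o phi) ->
  (\int[P]_w phi (X k w)) = \int[mu]_x phi x.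
Proof.
move=> iphi; have [mX _ _] := hX; rewrite /Rintegral (sample_integral k).
rewrite integral_pushforward //; last exact: (sample_integrable k iphi).
by have [] := integrableP _ _ _ iphi.
Qed.

(** Cross terms vanish by independence and centering, so only the [K] diagonal terms remain. Square
    integrability gives integrability of [phi], dominated by [phi ^+ 2 + 1]. *)
Lemma sample_sum_sqr (phi : T -> R) : measurable_fun setT phi ->
  mu.-integrable setT (EFin \o (fun x => phi x ^+ 2)) ->
  (\int[mu]_x phi x) = 0 ->
  P.-integrable setT (EFin \o (fun w => (\sum_k phi (X k w)) ^+ 2)) /\
  (\int[P]_w ((\sum_k phi (X k w)) ^+ 2)) = K%:R * \int[mu]_x (phi x ^+ 2).
Proof.
move=> mphi iphi2 phi0; have [mX _ iX] := hX.
have mphiX k : measurable_fun setT (fun w => phi (X k w)) by exact: measurableT_comp.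
have i1 : mu.-integrable setT (EFin \o (fun=> 1 : R)).
  by apply: bounded_measurable_integrable => //; exists 1 => x; rewrite normr1.
have iphi : mu.-integrable setT (EFin \o phi).
  have i2 := integrableD measurableT iphi2 i1.
  apply: (le_integrable measurableT _ _ i2); first exact/measurable_EFinP.
  move=> x _ /=; rewrite lee_fin [leRHS]ger0_norm ?addr_ge0 ?sqr_ge0 //.
  have := sqr_ge0 (`|phi x| - 1); rewrite -[phi x ^+ 2]real_normK ?num_real //.
  by move: `|phi x| (normr_ge0 (phi x)) => y y0; rewrite expr2; lra.
have i2X k : P.-integrable setT (EFin \o (fun w => phi (X k w) ^+ 2)).
  exact: (sample_integrable k iphi2).
have iXX k l : P.-integrable setT (EFin \o (fun w => phi (X k w) * phi (X l w))).
  apply: (le_integrable measurableT _ _ (integrableD measurableT (i2X k) (i2X l))).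
    by apply/measurable_EFinP; exact: measurable_funM.
  move=> w _ /=; rewrite lee_fin [leRHS]ger0_norm ?addr_ge0 ?sqr_ge0 // normrM.
  rewrite -[phi (X k w) ^+ 2]real_normK ?num_real //.
  rewrite -[phi (X l w) ^+ 2]real_normK ?num_real //.
  have := sqr_ge0 (`|phi (X k w)| - `|phi (X l w)|).
  have := mulr_ge0 (normr_ge0 (phi (X k w))) (normr_ge0 (phi (X l w))).
  by move: `|phi (X k w)| `|phi (X l w)| => x y; rewrite !expr2; lra.
have sE : (fun w => (\sum_k phi (X k w)) ^+ 2) =
    (fun w => \sum_k \sum_l phi (X k w) * phi (X l w)).
  apply/funext => w; rewrite expr2 mulr_suml; apply: eq_bigr => k _.
  by rewrite mulr_sumr.
have iR k : P.-integrable setT (EFin \o (fun w => \sum_l phi (X k w) * phi (X l w))).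
  exact: integrable_EFin_sum.
split; first by rewrite sE; exact: integrable_EFin_sum.
rewrite sE Rintegral_sum //.
rewrite -[K in RHS]card_ord -sumr_const mulr_suml; apply: eq_bigr => k _.
rewrite Rintegral_sum // (bigD1 k) //= big1 ?addr0 => [|l lk].
  rewrite mul1r -(sample_Rintegral k iphi2).
  by apply: eq_Rintegral => w _; rewrite expr2.
rewrite (@Rintegral_histM _ _ _ _ _ _ P _ mX iX [set k]%SET l
  (fun w => phi (X k w)) phi) //.
- by rewrite !sample_Rintegral // phi0 mulr0.
- by rewrite inE.
- by apply: (hist_measurable_comp (Z := phi)) => //; rewrite inE.
- exact: sample_integrable.
- exact: sample_integrable.
- exact: iXX.
Qed.

End IidMoments.

(** * Pointwise Gram matrices and the normal equations *)

Section Gram.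
Context (R : realType) (m N : nat).
Implicit Types (g : 'I_N -> 'cV[R]_m) (v : 'cV[R]_N).

Definition gram g : 'M[R]_N := \matrix_(i, j) dotv (g i) (g j).

Lemma symmx_gram g : symmx (gram g).
Proof. by apply/matrixP => i j; rewrite !mxE dotvC. Qed.

Lemma qform_gram g v :
  qform (gram g) v = dotv (\sum_j v j 0 *: g j) (\sum_j v j 0 *: g j).
Proof.
rewrite /qform mxE dotv_sumr; apply: eq_bigr => j _.
rewrite dotvZr dotv_suml mulrC mxE; congr (_ * _).
by apply: eq_bigr => i _; rewrite !mxE dotvZl.
Qed.

Lemma psd_gram g : psd (gram g).
Proof. by move=> v; rewrite qform_gram dotv_ge0. Qed.

(** With [z] the combination of the [g j] with coefficients [v], the entries of [gram g *m v] are
    the products [dotv (g i) z], so Cauchy-Schwarz bounds its squared length by [M * dotv z z].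
    Comparing the square with [M] times the matrix encodes the eigenvalue bound [M]. *)
Lemma psd_gram_sqr g (M : R) : \sum_j dotv (g j) (g j) <= M ->
  psd (M *: gram g - gram g ^+ 2).
Proof.
move=> hM v; rewrite qformD qformN qformZ subr_ge0 expr2.
rewrite -{1}(symmx_gram g) qform_sqr qform_gram qform1.
set z := \sum_j v j 0 *: g j; apply: (@le_trans _ _ (\sum_i dotv (g i) (g i) * dotv z z)).
  apply: ler_sum => i _; rewrite mxE.
  have -> : \sum_j gram g i j * v j 0 = dotv (g i) z.
    by rewrite dotv_sumr; apply: eq_bigr => j _; rewrite dotvZr mxE mulrC.
  exact: dotv_sqr_le.
by rewrite -mulr_suml ler_wpM2r // dotv_ge0.
Qed.

Lemma gram_entry_le g (M : R) i j : \sum_j dotv (g j) (g j) <= M -> `|gram g i j| <= M.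
Proof.
move=> hM; have h l : dotv (g l) (g l) <= M.
  apply: le_trans hM; rewrite (bigD1 l) //= lerDl.
  by apply: sumr_ge0 => k _; exact: dotv_ge0.
rewrite mxE; apply: le_trans (dotv_le_half _ _) _.
by move: (h i) (h j); move: (dotv _ _) (dotv _ _) => x y; lra.
Qed.

End Gram.

(* [g], [e], [s] are the values at the sample points of the basis gradients, of the projection
   residual and of the data errors; [c] holds the coefficients of the least-squares solution
   minus the projection. *)
Lemma least_squares_coef_bound (R : realType) (m N K : nat) (g : 'I_N -> 'I_K -> 'cV[R]_m)
    (e s : 'I_K -> 'cV[R]_m) (c : 'cV[R]_N) (tau : R) : (0 < K)%N ->
  (forall k, dotv (s k) (s k) <= tau ^+ 2) ->
  let q k := \sum_j c j 0 *: g j k in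
  \sum_k dotv (e k + s k - q k) (q k) = 0 ->
  K%:R / 2 * qform 1 c <= qform (\sum_k gram (g^~ k)) c ->
  qform 1 c <= 8 / K%:R ^+ 2 * (\sum_j (\sum_k dotv (g j k) (e k)) ^+ 2) +
    8 * tau ^+ 2 / K%:R * (\sum_k \sum_j dotv (g j k) (g j k)).
Proof.
move=> K0 hs q orth lower; have KR : (0 : R) < K%:R by rewrite ltr0n.
have Kn0 : (K%:R : R) != 0 by rewrite gt_eqF.
pose b1 j := (\sum_k dotv (g j k) (e k)) / K%:R.
pose b2 j := (\sum_k dotv (g j k) (s k)) / K%:R.
have qq : qform (\sum_k gram (g^~ k)) c = \sum_k dotv (q k) (q k).
  rewrite /qform mulmx_sumr mulmx_suml summxE; apply: eq_bigr => k _.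
  exact: qform_gram.
have qE : \sum_k dotv (q k) (q k) = K%:R * \sum_j c j 0 * (b1 j + b2 j).
  move: orth; under eq_bigr do rewrite dotvDl dotvNl.
  rewrite big_split sumrN /= => /subr0_eq <-.
  under eq_bigr do rewrite {1}/q dotv_sumr.
  rewrite exchange_big mulr_sumr; apply: eq_bigr => j _ /=.
  have -> : K%:R * (c j 0 * (b1 j + b2 j)) =
      c j 0 * (\sum_k dotv (g j k) (e k) + \sum_k dotv (g j k) (s k)).
    by rewrite /b1 /b2; field.
  rewrite -big_split mulr_sumr; apply: eq_bigr => k _.
  by rewrite dotvZr dotvDl !(dotvC (g j k)).
(* Half of [qform 1 c] is at most the product of [c] with [b1 + b2], and absorbing a quarter of it
   gives the factor [4]. Separating [b1] from [b2] doubles this to the [8] of the conclusion. *)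
have step1 : qform 1 c <= 4 * \sum_j (b1 j + b2 j) ^+ 2.
  have h1 : qform 1 c / 2 <= \sum_j c j 0 * (b1 j + b2 j).
    by rewrite -(ler_pM2l KR) -qE -qq mulrCA mulrC; move: lower; lra.
  have h2 : \sum_j c j 0 * (b1 j + b2 j) <= qform 1 c / 4 + \sum_j (b1 j + b2 j) ^+ 2.
    rewrite qform1 mulr_suml -big_split; apply: ler_sum => j _ /=.
    rewrite -subr_ge0; have := sqr_ge0 (c j 0 / 2 - (b1 j + b2 j)).
    by move: (c j 0) (b1 j + b2 j) => x y; rewrite !expr2; lra.
  by move: h1 h2; move: (qform 1 c) (\sum_j _ * _) (\sum_j _) => x y z; lra.
have step2 : \sum_j (b1 j + b2 j) ^+ 2 <= 2 * (\sum_j b1 j ^+ 2) + 2 * \sum_j b2 j ^+ 2.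
  rewrite !mulr_sumr -big_split; apply: ler_sum => j _ /=.
  rewrite -subr_ge0; have := sqr_ge0 (b1 j - b2 j).
  by move: (b1 j) (b2 j) => x y; rewrite !expr2; lra.
(* The data errors may be arbitrarily correlated, so the sum over samples is handled by
   Cauchy-Schwarz and not by cancellation. *)
have step3 : \sum_j b2 j ^+ 2 <= tau ^+ 2 / K%:R * (\sum_k \sum_j dotv (g j k) (g j k)).
  rewrite exchange_big mulr_sumr; apply: ler_sum => j _.
  have /= := sum_Cauchy_Schwarz (fun=> 1) (fun k => dotv (g j k) (s k)).
  under eq_bigr do rewrite mul1r.
  rewrite sumr_const card_ord expr1n => CS.
  rewrite /b2 expr_div_n ler_pdivrMr ?exprn_gt0 //; apply: le_trans CS _.
  have -> : tau ^+ 2 / K%:R * (\sum_k dotv (g j k) (g j k)) * K%:R ^+ 2 =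
      K%:R * (\sum_k dotv (g j k) (g j k) * tau ^+ 2).
    by rewrite -mulr_suml; field.
  apply: ler_wpM2l; first exact: ltW.
  apply: ler_sum => k _; apply: le_trans (dotv_sqr_le _ _) _.
  by rewrite ler_wpM2l // dotv_ge0.
have b1E : \sum_j b1 j ^+ 2 = (\sum_j (\sum_k dotv (g j k) (e k)) ^+ 2) / K%:R ^+ 2.
  by rewrite mulr_suml; apply: eq_bigr => j _; rewrite /b1 expr_div_n.
move: step1 step2 step3; rewrite b1E.
have -> : 8 / K%:R ^+ 2 * (\sum_j (\sum_k dotv (g j k) (e k)) ^+ 2) =
  8 * ((\sum_j (\sum_k dotv (g j k) (e k)) ^+ 2) / K%:R ^+ 2) by ring.
have -> : 8 * tau ^+ 2 / K%:R * (\sum_k \sum_j dotv (g j k) (g j k)) =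
  8 * (tau ^+ 2 / K%:R * (\sum_k \sum_j dotv (g j k) (g j k))) by ring.
move: (qform 1 c) (\sum_j (b1 j + b2 j) ^+ 2) (\sum_j b2 j ^+ 2) (_ / _ ^+ 2) (_ / _ * _).
by move=> x y z t u; lra.
Qed.

Lemma symplJ_gram (R : realType) d : symplJ R d *m (symplJ R d)^T = 1%:M.
Proof.
rewrite /symplJ tr_block_mx !linear0 linearN /= trmx1 mulmx_block.
rewrite !mulmx0 !mul0mx !mulmx1 mulmxN mulNmx mulmx1 opprK !addr0 !add0r.
by rewrite -scalar_mx_block.
Qed.

Lemma symplJ_unit (R : realType) d : symplJ R d \in unitmx.
Proof. by have /mulmx1_unit[] := symplJ_gram R d. Qed.

Lemma dotv_symplJ (R : realType) d (v : 'cV[R]_(d + d)) :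
  dotv (symplJ R d *m v) (symplJ R d *m v) = dotv v v.
Proof.
have dotE (w : 'cV[R]_(d + d)) : dotv w w = (w^T *m w) 0 0.
  by rewrite mxE; apply: eq_bigr => i _; rewrite mxE.
by rewrite !dotE trmx_mul mulmxA -(mulmxA v^T) (mulmx1C (symplJ_gram R d)) mulmx1.
Qed.

(** * Square-integrable fields and their extension by zero *)

Section L2Fields.
Context (R : realType) (n : nat).
Variable omega : probability (borelcV R n) R.
Variable D : set 'cV[R]_n.
Hypothesis mD : measurable (D : set (borelcV R n)).
Local Notation E := 'cV[R]_n.
Local Notation T := (borelcV R n).
Implicit Types f g : E -> E.

Definition L2field f := measurable_field (D : set T) (f : T -> E) /\
  omega.-integrable (D : set T) (EFin \o (fun x : T => dotv (f x) (f x))).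

Lemma L2sqE f : L2sq omega D f = (\int[omega]_(x in (D : set T)) (dotv (f x) (f x))%:E)%E.
Proof. by apply: eq_integral => x _; rewrite norm2_sqr. Qed.

Lemma L2sq_fin f : L2field f -> L2sq omega D f = (L2dot omega D f f)%:E.
Proof.
move=> [_ hf]; rewrite L2sqE /L2dot /Rintegral fineK //.
exact: (integrable_fin_num mD hf).
Qed.

Lemma sobolev1_L2field u : sobolev1 omega D u -> L2field u.2.
Proof.
move=> [m1 m2 H1 _]; have m2' := measurable_fun_borelcV m2.
have mdot := measurable_field_dotv m2' m2'.
split => //; apply/integrableP; split; first exact/measurable_EFinP.
apply: le_lt_trans H1; apply: ge0_le_integral => //.
- by apply: measurableT_comp => //; exact/measurable_EFinP.
- apply/measurable_EFinP; apply: measurable_funD; first exact: measurable_funX.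
  by under eq_fun do rewrite norm2_sqr.
- move=> x _; rewrite abse_EFin lee_fin ger0_norm ?dotv_ge0 // norm2_sqr.
  by rewrite lerDr sqr_ge0.
Qed.

Lemma L2field_dot f g : L2field f -> L2field g ->
  omega.-integrable (D : set T) (EFin \o (fun x : T => dotv (f x) (g x))).
Proof.
move=> [mf hf] [mg hg].
apply: (le_integrable mD _ _ (integrableD mD hf hg)).
  by apply/measurable_EFinP; exact: measurable_field_dotv.
move=> x _ /=; rewrite lee_fin [leRHS]ger0_norm ?addr_ge0 ?dotv_ge0 //.
apply: le_trans (dotv_le_half _ _) _.
have := dotv_ge0 (f x); have := dotv_ge0 (g x).
by move: (dotv _ _) (dotv _ _) => a b; lra.
Qed.

Lemma L2field_addZ f g a : L2field f -> L2field g ->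
  L2field (fun x => f x + a *: g x).
Proof.
move=> Lf Lg; have [mf hf] := Lf; have [mg hg] := Lg.
have maf : measurable_field (D : set T) ((fun x : T => f x + a *: g x) : T -> E).
  by apply: measurable_fieldD => //; apply: measurable_fieldM.
split => //.
have hfg := L2field_dot Lf Lg.
rewrite (_ : EFin \o _ = EFin \o (fun x : T => (dotv (f x) (f x) +
   (2 * a) * dotv (f x) (g x)) + a ^+ 2 * dotv (g x) (g x))).
  have h1 := integrableZl mD (2 * a) hfg.
  have h2 := integrableZl mD (a ^+ 2) hg.
  exact: (integrableD mD (integrableD mD hf h1) h2).
apply/funext => x /=; congr EFin.
by rewrite !(dotvDl, dotvDr, dotvZl, dotvZr) (dotvC (g x)); ring.
Qed.

Lemma L2dot_addZ f g a : L2field f -> L2field g ->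
  L2dot omega D (fun x => f x + a *: g x) (fun x => f x + a *: g x) =
  L2dot omega D f f + 2 * a * L2dot omega D f g + a ^+ 2 * L2dot omega D g g.
Proof.
move=> Lf Lg; have [mf hf] := Lf; have [mg hg] := Lg.
have hfg := L2field_dot Lf Lg.
have h1 := integrableZl mD (2 * a) hfg.
have h2 := integrableZl mD (a ^+ 2) hg.
have hs := integrableD mD hf h1.
rewrite /L2dot -!RintegralZl // -!RintegralD //.
apply: eq_Rintegral => x _.
by rewrite !(dotvDl, dotvDr, dotvZl, dotvZr) (dotvC (g x)); ring.
Qed.

Lemma L2dot_ge0 f : 0 <= L2dot omega D f f.
Proof. by apply: Rintegral_ge0 => x _; exact: dotv_ge0. Qed.

Lemma L2dot_orthonormal_comb N (g : 'I_N -> E -> E) (c : 'cV[R]_N) (q : E -> E) :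
  (forall j, L2field (g j)) -> orthonormal_fields omega D g ->
  (forall x, D x -> q x = \sum_j c j 0 *: g j x) ->
  L2dot omega D q q = qform 1 c.
Proof.
move=> Lg og hq.
transitivity (\int[omega]_(x in (D : set T))
    (\sum_i \sum_j (c i 0 * c j 0) * dotv (g i x) (g j x))).
  apply: eq_Rintegral => x /set_mem Dx; rewrite hq // dotv_suml.
  apply: eq_bigr => i _; rewrite dotv_sumr; apply: eq_bigr => j _.
  by rewrite dotvZl dotvZr mulrA.
have iij i j : omega.-integrable (D : set T)
    (EFin \o (fun x : T => (c i 0 * c j 0) * dotv (g i x) (g j x))).
  exact: (integrableZl mD _ (L2field_dot (Lg i) (Lg j))).
rewrite Rintegral_sum // => [|i]; last exact: integrable_EFin_sum.
rewrite qform1; apply: eq_bigr => i _.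
rewrite Rintegral_sum // (bigD1 i) //= big1 ?addr0 => [|j ji].
  rewrite RintegralZl //; last exact: L2field_dot.
  by have := og i i; rewrite /L2dot => ->; rewrite eqxx mulr1 expr2.
rewrite RintegralZl //; last exact: L2field_dot.
by have := og i j; rewrite /L2dot => ->; rewrite eq_sym (negbTE ji) mulr0.
Qed.

(* The gradients are measurable on [D] only, but the sampling lemmas need fields on [T]. *)
Definition extend0 (f : E -> E) : T -> E := patch (fun=> 0) D f.

Lemma extend0_in f x : D x -> extend0 f x = f x.
Proof. by move=> Dx; rewrite /extend0 /patch mem_set. Qed.

Lemma extend0_out f x : ~ D x -> extend0 f x = 0.
Proof. by move=> Dx; rewrite /extend0 /patch memNset. Qed.

Lemma measurable_extend0 f : L2field f -> measurable_field setT (extend0 f).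
Proof.
move=> [mf _] i.
have -> : (fun x => extend0 f x i 0) = (fun x => f x i 0) \_ D.
  apply/funext => x; rewrite /extend0 /patch; case: ifP => // _.
  by rewrite mxE.
by apply/measurable_restrict => //; rewrite setTI; exact: mf.
Qed.

Lemma dotv_extend0E f g : (fun x => dotv (extend0 f x) (extend0 g x)) =
  (fun x => dotv (f x) (g x)) \_ D.
Proof.
apply/funext => x; rewrite /extend0 /patch; case: ifP => // _; exact: dot0v.
Qed.

Lemma integrable_extend0 f g : L2field f -> L2field g ->
  omega.-integrable setT (EFin \o (fun x => dotv (extend0 f x) (extend0 g x))).
Proof.
move=> Lf Lg; rewrite dotv_extend0E.
have := L2field_dot Lf Lg; rewrite (integrable_mkcond _ mD).
by rewrite restrict_EFin.
Qed.

Lemma Rintegral_extend0 f g :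
  \int[omega]_x dotv (extend0 f x) (extend0 g x) = L2dot omega D f g.
Proof.
by rewrite /L2dot [RHS]Rintegral_mkcond -dotv_extend0E.
Qed.

End L2Fields.

(** * Linearity of the gradient space and orthogonality of minimizers *)

Lemma grads_addZ (R : realType) n (W : set (('cV[R]_n -> R) * ('cV[R]_n -> 'cV[R]_n)))
    u v (a : R) : findim_subspace W -> grads W u -> grads W v ->
  grads W (fun x => u x + a *: v x).
Proof.
move=> [m [b ->]] [_ [c _ <-] <-] [_ [c' _ <-] <-].
exists (\sum_i (c i + a * c' i) *: b i); first by exists (fun i => c i + a * c' i).
have -> : \sum_i (c i + a * c' i) *: b i = \sum_i c i *: b i + a *: \sum_i c' i *: b i.
  by rewrite scaler_sumr -big_split; apply: eq_bigr => i _; rewrite scalerDl scalerA.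
by [].
Qed.

Section Projections.
Context (R : realType) (n : nat).
Variable omega : probability (borelcV R n) R.
Variable D : set 'cV[R]_n.
Hypothesis mD : measurable (D : set (borelcV R n)).
Local Notation E := 'cV[R]_n.
Variable V : set (E -> E).
Hypothesis V_addZ : forall u v (a : R), V u -> V v -> V (fun x => u x + a *: v x).

Lemma L2_projection_orthogonal (f p v : E -> E) :
  (forall u, V u -> L2field omega D u) -> L2field omega D f ->
  L2_projection omega D V f p -> V v ->
  L2dot omega D (fun x => f x - p x) v = 0.
Proof.
move=> VL Lf [Vp minp] Vv.
have Le : L2field omega D (fun x => f x - p x).
  have := L2field_addZ mD (- 1) Lf (VL _ Vp).
  by under eq_fun do rewrite scaleN1r.
apply: (@nonneg_quadratic_linear0 _ _ (L2dot omega D v v)) => t.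
have := minp _ (V_addZ t Vp Vv).
rewrite [X in (X <= _)%E](L2sq_fin mD Le).
have -> : f - (fun x => p x + t *: v x) = (fun x => (f x - p x) + (- t) *: v x).
  by apply/funext => x; rewrite !fctE scaleNr opprD addrA.
rewrite (L2sq_fin mD (L2field_addZ mD (- t) Le (VL _ Vv))) lee_fin.
rewrite (L2dot_addZ mD _ Le (VL _ Vv)) sqrrN.
by move: (L2dot _ _ _ _) (L2dot _ _ _ _) (L2dot _ _ _ _) => x y z; lra.
Qed.

Lemma ls_minimizer_orthogonal K (x y : 'I_K -> E) (u v : E -> E) :
  ls_minimizer V x y u -> V v ->
  \sum_k dotv (y k - u (x k)) (v (x k)) = 0.
Proof.
move=> [Vu minu] Vv.
apply: (@nonneg_quadratic_linear0 _ _ (\sum_k dotv (v (x k)) (v (x k)))) => t.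
have := minu _ (V_addZ t Vu Vv); rewrite -subr_ge0 -sumrB.
rewrite (_ : - (2 * t * _) + _ = \sum_k (norm2 (y k - (u (x k) + t *: v (x k))) ^+ 2
   - norm2 (y k - u (x k)) ^+ 2)) //.
rewrite -mulNr !mulr_sumr -big_split; apply: eq_bigr => k _ /=.
rewrite !norm2_sqr opprD addrA; move: (y k - u (x k)) (v (x k)) => a b.
by rewrite !(dotvDl, dotvDr, dotvNl, dotvNr, dotvZl, dotvZr) (dotvC b a); ring.
Qed.

End Projections.

(** * The numerical rate *)

(** The value [5 / 12] is exactly what makes [(3 * ln (3 / 2) - 1) / 2] at most [1 / 8]; the power
    [(1 + 5 / 96) ^+ 8] already exceeds [3 / 2]. *)
Lemma ln_3_2_le (R : realType) : ln (3 / 2 : R) <= 5 / 12.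
Proof.
rewrite -[leRHS]expRK ler_ln ?posrE ?expR_gt0 ?divr_gt0 //.
have -> : 5 / 12 = 8%:R * (5 / 96) :> R by field.
rewrite expRM_natl; apply: (@le_trans _ _ ((1 + 5 / 96) ^+ 8)); first by lra.
by apply: lerXn2r; rewrite ?nnegrE ?expR_ge0 ?expR_ge1Dx //; lra.
Qed.

(** The exponent is [ln K / (8 * lambda)], which is at least [(1 + r) * ln K] exactly when
    [lambda * (1 + r) <= 1 / 8]. The factor [K^-1] is kept apart to pay for the dimension
    [N < K]. *)
Lemma expR_rate_le (R : realType) (K : nat) (r lambda : R) : (1 < K)%N -> 0 < r ->
  0 < lambda -> lambda = (3 * ln (3 / 2) - 1) / (2 + 2 * r) ->
  expR (- (K%:R / (8 * (lambda * (K%:R / ln K%:R))))) <= K%:R^-1 * (K%:R `^ r)^-1.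
Proof.
move=> K1 r0 l0 lE; have KR : (0 : R) < K%:R by rewrite ltr0n ltnW.
have lnK0 : 0 < ln (K%:R : R) by rewrite ln_gt0 // ltr1n.
have lr : lambda * (1 + r) <= 1 / 8.
  have -> : lambda * (1 + r) = (3 * ln (3 / 2) - 1) / 2.
    by rewrite lE; field; rewrite gt_eqF //; lra.
  by have := ln_3_2_le R; move: (ln _) => x; lra.
have -> : (K%:R `^ r)^-1 = expR (- (r * ln K%:R)).
  by rewrite /powR gt_eqF // expRN.
have -> : K%:R / (8 * (lambda * (K%:R / ln K%:R))) = ln K%:R / (8 * lambda) :> R.
  by field; rewrite !gt_eqF.
have -> : K%:R^-1 = expR (- ln K%:R) :> R by rewrite expRN lnK ?posrE.
rewrite -expRD ler_expR -opprD lerN2 ler_pdivlMr ?mulr_gt0 //.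
have -> : (ln K%:R + r * ln K%:R) * (8 * lambda) = 8 * (lambda * (1 + r)) * ln K%:R.
  by ring.
apply: ler_piMl; first exact: ltW.
by move: lr; move: (lambda * (1 + r)) => x; lra.
Qed.

(** * Error decomposition and expectation *)

Theorem theorem3p4 (R : realType) (d : nat) (hd : (0 < d)%N)
  (D : set 'cV[R]_(d + d)) (hD : bounded_domain D)
  (omega : probability (borelcV R (d + d)) R) (homega : omega D = 1%E)
  (H : 'cV[R]_(d + d) -> R) (HC1 : C1_on D H)
  (HH1 : sobolev1 omega D (H, grad H))
  (W : set (('cV[R]_(d + d) -> R) * ('cV[R]_(d + d) -> 'cV[R]_(d + d))))
  (hWH1 : W `<=` sobolev1 omega D) (hW : findim_subspace W)
  (N : nat) (hN : (0 < N)%N)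
  (phi : 'I_N -> ('cV[R]_(d + d) -> R) * ('cV[R]_(d + d) -> 'cV[R]_(d + d)))
  (hphiW : forall j, W (phi j))
  (hphi : basis_on D (grads W) (fun j => (phi j).2))
  (hortho : orthonormal_fields omega D (fun j => (phi j).2))
  (dO : measure_display) (Omega : measurableType dO) (P : probability Omega R)
  (K : nat) (hNK : (N < K)%N)
  (X : 'I_K -> Omega -> borelcV R (d + d)) (hX : iid_sample P omega X)
  (hXD : forall k w, D (X k w))
  (Xdot : 'I_K -> Omega -> borelcV R (d + d))
  (hXdot : forall k, measurable_fun setT (Xdot k))
  (tau_inf : R)
  (htau : forall k w, norm2 ((Xdot k w : 'cV[R]_(d + d))
      - invmx (symplJ R d) *m grad H (X k w)) <= tau_inf)
  (gradHt : Omega -> 'cV[R]_(d + d) -> 'cV[R]_(d + d))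
  (hHt : forall w, ls_minimizer (grads W) (fun k => X k w)
      (fun k => symplJ R d *m (Xdot k w : 'cV[R]_(d + d))) (gradHt w))
  (L : R) (hL : {ae omega, forall x, D x -> norm2 (grad H x) <= L})
  (hmeas : measurable_fun setT
      ((fun w => L2sq omega D (grad H - (truncT L \o gradHt w)))
        : Omega -> \bar R))
  (r : R) (hr : 0 < r)
  (lambda : R) (hlambda : lambda = (3 * ln (3 / 2) - 1) / (2 + 2 * r))
  (hK : (KN D (fun j => (phi j).2) <= (lambda * (K%:R / ln K%:R))%:E)%E)
  (PiH : 'cV[R]_(d + d) -> 'cV[R]_(d + d))
  (hPi : L2_projection omega D (grads W) (grad H) PiH) :
  (\int[P]_w L2sq omega D (grad H - (truncT L \o gradHt w))%R
   <= (1 + 8 * lambda / ln K%:R)%:E * L2sq omega D (grad H - PiH)%R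
      + (8 * L ^+ 2 / K%:R `^ r + 8 * N%:R * tau_inf ^+ 2)%:E)%E.
Proof.
have mD : measurable (D : set (borelcV R (d + d))).
  by case: hD => oD _ _ _; exact: open_measurable_borelcV.
have V_addZ u v (a : R) : grads W u -> grads W v -> grads W (fun x => u x + a *: v x).
  exact: grads_addZ.
have VL u : grads W u -> L2field omega D u.
  by move=> [w /hWH1 Ww <-]; exact: sobolev1_L2field mD _ Ww.
have Lf : L2field omega D (grad H) by exact: (sobolev1_L2field mD HH1).
pose g j := (phi j).2.
have Vg j : grads W (g j) by exists (phi j).
have Lg j : L2field omega D (g j) by exact: VL.
have [Vp _] := hPi.
pose e x := grad H x - PiH x.
have Le : L2field omega D e.
  have := L2field_addZ mD (- 1) Lf (VL _ Vp).
  by under eq_fun do rewrite scaleN1r.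
have eV v : grads W v -> L2dot omega D e v = 0.
  exact: (L2_projection_orthogonal mD V_addZ VL Lf hPi).
have K1 : (1 < K)%N by exact: leq_ltn_trans hNK.
have K0 : (0 < K)%N by exact: ltnW.
have KR : (0 : R) < K%:R by rewrite ltr0n.
have lnK : 0 < ln (K%:R : R) by rewrite ln_gt0 // ltr1n.
have KNg x : D x -> \sum_j dotv (g j x) (g j x) <= lambda * (K%:R / ln K%:R).
  move=> Dx; rewrite -lee_fin; apply: le_trans hK; apply: ereal_sup_ubound.
  by exists x => //; congr EFin; apply: eq_bigr => j _; rewrite norm2_sqr.
set M := lambda * _ in KNg.
(* A negative [L] would make [D] negligible, although it has measure [1]. *)
have L0 : 0 <= L.
  rewrite leNgt; apply/negP => Lneg.
  have : omega.-negligible D.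
    apply: negligibleS hL => x Dx /= /(_ Dx) h.
    by have := le_lt_trans h Lneg; rewrite ltNge norm2_ge0.
  move=> /(measure_negligible mD) /eqP.
  by rewrite [X in (X == _)]homega onee_eq0.
pose gD j := extend0 D (g j); pose eD := extend0 D e.
have mgD j := measurable_extend0 mD (Lg j).
have meD := measurable_extend0 mD Le.
have igD i j := integrable_extend0 mD (Lg i) (Lg j).
have gDM' x : D x -> \sum_j dotv (gD j x) (gD j x) <= M.
  by move=> Dx; under eq_bigr do rewrite /gD extend0_in //; exact: KNg.
have gD0 x : ~ D x -> \sum_j dotv (gD j x) (gD j x) = 0.
  by move=> Dx; rewrite big1 // => j _; rewrite /gD extend0_out // dot0v.
have M0 : 0 <= M.
  have [[x Dx]|nD] := pselect (exists x, D x).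
    by apply: le_trans (gDM' x Dx); apply: sumr_ge0 => j _; exact: dotv_ge0.
  by case: hD => _ _ [x Dx] _; case: nD; exists x.
have gDM x : \sum_j dotv (gD j x) (gD j x) <= M.
  by have [/gDM' //|/gD0 ->] := pselect (D x).
have EgD i j : \int[omega]_x dotv (gD i x) (gD j x) = (i == j)%:R.
  by rewrite Rintegral_extend0; exact: hortho.
(* Orthonormality makes [N] the mean of the pointwise sum of squared norms, which [M] bounds. Hence
   [M >= 1], and [lambda] is positive. *)
have NM : N%:R <= M.
  rewrite -[M](Rintegral_cst_probability omega).
  have -> : N%:R = \int[omega]_x (\sum_j dotv (gD j x) (gD j x)).
    rewrite Rintegral_sum // => [|j]; last exact: igD.
    by under eq_bigr do rewrite EgD eqxx; rewrite sumr_const card_ord.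
  apply: le_Rintegral => //; first by apply: integrable_EFin_sum => // j; exact: igD.
  by apply: bounded_measurable_integrable => //; exists `|M|.
have M1 : 1 <= M by apply: le_trans NM; rewrite ler1n.
have lambda0 : 0 < lambda.
  rewrite -(pmulr_lgt0 (x := K%:R / ln K%:R)) ?divr_gt0 //.
  exact: lt_le_trans M1.
have rate : 2 * N%:R * expR (- (K%:R / (8 * M))) <= 2 * (K%:R `^ r)^-1.
  rewrite -mulrA ler_pM2l //.
  have := expR_rate_le K1 hr lambda0 hlambda; rewrite -/M => h.
  apply: (@le_trans _ _ (N%:R * (K%:R^-1 * (K%:R `^ r)^-1))); first exact: ler_wpM2l.
  rewrite mulrA ler_piMl ?invr_ge0 ?powR_ge0 //.
  by rewrite ler_pdivrMr // mul1r ler_nat ltnW.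
pose Q x := gram (gD^~ x).
have mQ i j : measurable_fun setT (fun x => Q x i j).
  by under eq_fun do rewrite mxE; exact: (measurable_field_dotv (mgD i) (mgD j)).
have EQ i j : \int[omega]_x Q x i j = (i == j)%:R.
  by rewrite -EgD; apply: eq_Rintegral => x _; rewrite mxE.
have [Phi [iPhi Phi0 PhiBad EPhi]] := matrix_Chernoff_lower hX mQ
  (fun x => symmx_gram _) (fun x => psd_gram _)
  (fun x => psd_gram_sqr (gDM x)) (fun x i j => gram_entry_le i j (gDM x)) EQ M1 K0.
pose E2 := L2dot omega D e e.
pose A w := \sum_j (\sum_k dotv (gD j (X k w)) (eD (X k w))) ^+ 2.
pose B w := \sum_k \sum_j dotv (gD j (X k w)) (gD j (X k w)).
(* The majorant: projection error, contributions of residual and data errors to the coefficients,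
   and [Phi] weighted by the worst error after truncation. *)
pose U w := E2 + (8 / K%:R ^+ 2 * A w + 8 * tau_inf ^+ 2 / K%:R * B w) +
  4 * L ^+ 2 * Phi w.
have ZU w : (L2sq omega D (grad H - (truncT L \o gradHt w))%R <= (U w)%:E)%E.
  have Vu : grads W (gradHt w) by case: (hHt w).
  have mu := (VL _ Vu).1; have mf := Lf.1.
  have mZ : measurable_field (D : set (borelcV R (d + d)))
      (fun x => grad H x - truncT L (gradHt w x)).
    by apply: measurable_fieldB => //; exact: measurable_field_truncT.
  have mZ2 : measurable_fun (D : set (borelcV R (d + d)))
      (fun x => (dotv (grad H x - truncT L (gradHt w x))
                      (grad H x - truncT L (gradHt w x)))%:E).
    by apply/measurable_EFinP; exact: measurable_field_dotv.
  have A0 : 0 <= A w by apply: sumr_ge0 => j _; exact: sqr_ge0.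
  have B0 : 0 <= B w by do 2! (apply: sumr_ge0 => ? _); exact: dotv_ge0.
  have AB0 : 0 <= 8 / K%:R ^+ 2 * A w + 8 * tau_inf ^+ 2 / K%:R * B w.
    apply: addr_ge0; apply: mulr_ge0 => //.
    by apply: divr_ge0 => //; apply: mulr_ge0 => //; exact: sqr_ge0.
  have E20 : 0 <= E2 by exact: L2dot_ge0.
  (* If some direction violates the Gram bound, then [Phi w >= 1] and the last term of [U] alone
     suffices. *)
  have [[v hv]|good] := pselect (exists v, qform (\sum_k Q (X k w)) v <
      K%:R / 2 * qform 1 v).
    apply: (@le_trans _ _ (4 * L ^+ 2)%:E).
      rewrite L2sqE.
      have -> : ((4 * L ^+ 2)%:E = \int[omega]_(x in (D : set (borelcV R (d + d))))
          (4 * L ^+ 2)%:E)%E.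
        by rewrite integral_cst // [X in (_ * X)%E]homega mule1.
      apply: ae_ge0_le_integral => //.
      - by move=> x _; rewrite lee_fin dotv_ge0.
      - by move=> x _; rewrite lee_fin mulr_ge0 ?sqr_ge0.
      - apply: (@filterS _ _ (ae_filter_ringOfSetsType omega) _ _ _ hL) => x hx Dx; rewrite lee_fin.
        by apply: truncT_dist_bound => //; exact: hx.
    rewrite lee_fin /U; apply: (@le_trans _ _ (4 * L ^+ 2 * Phi w)).
      by rewrite ler_peMr ?mulr_ge0 ?sqr_ge0 //; exact: PhiBad hv.
    by rewrite lerDr addr_ge0.
  have Vq : grads W (fun x => gradHt w x + (- 1) *: PiH x) by exact: V_addZ.
  set q := (fun x => _) in Vq.
  have [_ _ /(_ q Vq) [c hc]] := hphi.
  pose cv : 'cV[R]_N := \col_j c j.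
  have hcv x : D x -> q x = \sum_j cv j 0 *: g j x.
    by move=> Dx; rewrite hc //; apply: eq_bigr => j _; rewrite mxE.
  have EQc : L2dot omega D q q = qform 1 cv.
    exact: (L2dot_orthonormal_comb mD Lg hortho hcv).
  apply: (@le_trans _ _ (E2 + qform 1 cv)%:E).
    have Lr := L2field_addZ mD (- 1) Le (VL _ Vq).
    (* Pythagoras: the untruncated error is [e - q], with [e] orthogonal to the gradient space and
       [q] in it. *)
    have -> : E2 + qform 1 cv = L2dot omega D (fun x => e x + (- 1) *: q x)
        (fun x => e x + (- 1) *: q x).
      by rewrite (L2dot_addZ mD _ Le (VL _ Vq)) (eV q Vq) mulr0 addr0 sqrrN expr1n mul1r EQc.
    rewrite -(L2sq_fin mD Lr) !L2sqE; apply: ae_ge0_le_integral => //.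
    - by move=> x _; rewrite lee_fin dotv_ge0.
    - by move=> x _; rewrite lee_fin dotv_ge0.
    - by case: Lr => mr _; apply/measurable_EFinP; exact: measurable_field_dotv.
    - apply: (@filterS _ _ (ae_filter_ringOfSetsType omega) _ _ _ hL) => x hx Dx; rewrite lee_fin.
      have -> : e x + (- 1) *: q x = grad H x - gradHt w x.
        by rewrite /e /q; apply/matrixP => i j; rewrite !mxE; ring.
      by apply: truncT_dist_le => //; exact: hx.
  rewrite lee_fin /U -addrA lerD2l.
  apply: (@le_trans _ _ (8 / K%:R ^+ 2 * A w + 8 * tau_inf ^+ 2 / K%:R * B w)); last first.
    by rewrite lerDl !mulr_ge0 ?sqr_ge0.
  (* This equals the data vector minus [grad H] at the sample point, so [e + s - q] is the
     least-squares residual; the symplectic matrix is orthogonal and preserves the bound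
     [tau_inf]. *)
  pose s k := symplJ R d *m ((Xdot k w : 'cV[R]_(d + d))
      - invmx (symplJ R d) *m grad H (X k w)).
  apply: (@least_squares_coef_bound _ _ _ _ (fun j k => gD j (X k w))
    (fun k => eD (X k w)) s cv tau_inf K0).
  - move=> k; rewrite dotv_symplJ -norm2_sqr.
    by rewrite lerXn2r ?nnegrE ?norm2_ge0 // (le_trans (norm2_ge0 _) (htau k w)).
  - rewrite -[RHS](ls_minimizer_orthogonal V_addZ (hHt w) Vq); apply: eq_bigr => k _.
    have qk : \sum_j cv j 0 *: gD j (X k w) = q (X k w).
      rewrite hcv //; apply: eq_bigr => j _; congr (_ *: _).
      exact: extend0_in (hXD k w).
    rewrite qk; congr dotv.
    rewrite /eD extend0_in // /s mulmxBr mulKVmx ?symplJ_unit //.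
    by rewrite /e /q; apply/matrixP => i j; rewrite !mxE; ring.
  - by rewrite leNgt; apply/negP => h; apply: good; exists cv.
(* The functions [dotv (gD j x) (eD x)] are centered because [e] is orthogonal to each basis
   gradient. The diagonal terms are summed over [j] by Cauchy-Schwarz before integrating, which
   costs [M] once and no factor [N]. *)
have [iA EA] : P.-integrable setT (EFin \o A) /\ (\int[P]_w A w) <= K%:R * (M * E2).
  have meDD := integrable_extend0 mD Le Le.
  have mphi j : measurable_fun setT (fun x => dotv (gD j x) (eD x)).
    exact: (measurable_field_dotv (mgD j) meD).
  have sumphi x : \sum_j dotv (gD j x) (eD x) ^+ 2 <= M * dotv (eD x) (eD x).
    apply: (@le_trans _ _ (\sum_j dotv (gD j x) (gD j x) * dotv (eD x) (eD x))).
      by apply: ler_sum => j _; exact: dotv_sqr_le.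
    by rewrite -mulr_suml ler_wpM2r // dotv_ge0.
  have iMe := integrableZl measurableT M meDD.
  have iphi2 j : omega.-integrable setT (EFin \o (fun x => dotv (gD j x) (eD x) ^+ 2)).
    apply: (le_integrable measurableT _ _ iMe).
      by apply/measurable_EFinP; exact: measurable_funX.
    move=> x _ /=; rewrite lee_fin ger0_norm ?sqr_ge0 //.
    rewrite ger0_norm; last by apply: mulr_ge0 => //; exact: dotv_ge0.
    apply: le_trans (sumphi x); rewrite (bigD1 j) //= lerDl.
    by apply: sumr_ge0 => i _; exact: sqr_ge0.
  have phi0 j : \int[omega]_x dotv (gD j x) (eD x) = 0.
    rewrite Rintegral_extend0 -(eV _ (Vg j)).
    by apply: eq_Rintegral => x _; exact: dotvC.
  have hA j := sample_sum_sqr hX (mphi j) (iphi2 j) (phi0 j).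
  split; first by apply: integrable_EFin_sum => // j; case: (hA j).
  rewrite Rintegral_sum // => [|j]; last by case: (hA j).
  rewrite (eq_bigr (fun j => K%:R * \int[omega]_x (dotv (gD j x) (eD x) ^+ 2))); last first.
    by move=> j _; case: (hA j).
  rewrite -mulr_sumr; apply: ler_wpM2l; first exact: ltW.
  rewrite -Rintegral_sum // /E2 -Rintegral_extend0 -RintegralZl //.
  by apply: le_Rintegral => //; exact: integrable_EFin_sum.
have [iB EB] : P.-integrable setT (EFin \o B) /\ (\int[P]_w B w) = K%:R * N%:R.
  have iBkj k j : P.-integrable setT
      (EFin \o (fun w => dotv (gD j (X k w)) (gD j (X k w)))).
    exact: (sample_integrable hX k (igD j j)).
  have iBk k : P.-integrable setT
      (EFin \o (fun w => \sum_j dotv (gD j (X k w)) (gD j (X k w)))).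
    exact: integrable_EFin_sum.
  split; first exact: integrable_EFin_sum.
  rewrite Rintegral_sum // -[K in RHS]card_ord -sumr_const mulr_suml.
  apply: eq_bigr => k _; rewrite mul1r Rintegral_sum // -[N in RHS]card_ord -sumr_const.
  apply: eq_bigr => j _.
  by rewrite (sample_Rintegral hX k (igD j j)) EgD eqxx.
have iE2 : P.-integrable setT (EFin \o (fun=> E2)).
  by apply: bounded_measurable_integrable => //; exists `|E2|.
have iaA := integrableZl measurableT (8 / K%:R ^+ 2) iA.
have ibB := integrableZl measurableT (8 * tau_inf ^+ 2 / K%:R) iB.
have icP := integrableZl measurableT (4 * L ^+ 2) iPhi.
have iAB := integrableD measurableT iaA ibB.
have iEAB := integrableD measurableT iE2 iAB.
have iU : P.-integrable setT (EFin \o U) by exact: (integrableD measurableT iEAB icP).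
have EU : (\int[P]_w U w) = E2 + (8 / K%:R ^+ 2 * (\int[P]_w A w) +
    8 * tau_inf ^+ 2 / K%:R * (\int[P]_w B w)) + 4 * L ^+ 2 * (\int[P]_w Phi w).
  rewrite RintegralD // RintegralD // RintegralD // !RintegralZl //.
  by rewrite Rintegral_cst_probability.
apply: (@le_trans _ _ (\int[P]_w (U w)%:E)%E).
  apply: ge0_le_integral => //.
  - by move=> w _; apply: integral_ge0 => x _; rewrite lee_fin sqr_ge0.
  - by case/integrableP: iU.
rewrite -(fineK (integrable_fin_num measurableT iU)) -/(Rintegral P setT U) EU EB.
rewrite (L2sq_fin mD Le) -EFinM -EFinD lee_fin -/E2.
(* The factor [8 / K ^ 2 * K * M] is [8 * M / K], which is [8 * lambda / ln K] by the choice of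
   [M]. *)
have hA : 8 / K%:R ^+ 2 * (\int[P]_w A w) <= 8 * lambda / ln K%:R * E2.
  apply: (@le_trans _ _ (8 / K%:R ^+ 2 * (K%:R * (M * E2)))).
    by apply: ler_wpM2l => //; rewrite divr_ge0 // exprn_ge0 // ltW.
  rewrite /M le_eqVlt; apply/orP; left; apply/eqP; field.
  by rewrite !gt_eqF.
have hB : 8 * tau_inf ^+ 2 / K%:R * (K%:R * N%:R) = 8 * N%:R * tau_inf ^+ 2.
  by field; rewrite gt_eqF.
have hP : 4 * L ^+ 2 * (\int[P]_w Phi w) <= 8 * L ^+ 2 / K%:R `^ r.
  have -> : 8 * L ^+ 2 / K%:R `^ r = 4 * L ^+ 2 * (2 * (K%:R `^ r)^-1) by ring.
  by apply: ler_wpM2l; [rewrite mulr_ge0 ?sqr_ge0|exact: le_trans EPhi rate].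
rewrite hB [(1 + _) * E2]mulrDl mul1r; move: hA hP.
move: (8 / _ * _) (8 * lambda / _ * _) (4 * _ * _) (8 * L ^+ 2 / _) (8 * N%:R * _).
by move=> x y z t u; lra.
Qed.
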